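(* Let $n\in\{1,2,3\}$ and $d_j=j^{-2}$ for $j\in\mathbb{N}$. Let $K\in L^1(\mathbb{R}^n)$ be a radial function, $K(x)=J(|x|)$, satisfying the following assumption, and let $h:[0,1]\to\mathbb{R}$ be defined accordingly. - If $n=1$: $J\in C([0,+\infty))$ and $\lim_{r\to+\infty}e^rJ(r)$ exists; $h(\lambda):=J(-\log\lambda)/\lambda$ for $\lambda\in(0,1]$ and $h(0):=\lim_{r\to+\infty}e^rJ(r)$. - If $n=2$: $J\in C^1([0,+\infty))$ and there exists $\alpha>1/2$ such that $\lim_{r\to+\infty}r^\alpha e^rJ'(r)$ exists; with $A(r):=-\frac{2r}{\pi}\int_0^{+\infty}J'(r\cosh s)\,ds$, $h(\lambda):=A(-\log\lambda)/\lambda$ for $\lambda\in(0,1]$ and $h(0):=\lim_{r\to+\infty}e^rA(r)=0$. - If $n=3$: $J\in C((0,+\infty))$ and both $\lim_{r\to+0}rJ(r)$ and $\lim_{r\to+\infty}re^rJ(r)$ exist; $h(\lambda):=-(\log\lambda)J(-\log\lambda)/\lambda$ for $\lambda\in(0,1)$, $h(0):=\lim_{r\to+\infty}re^rJ(r)$ and $h(1):=\lim_{r\to+0}rJ(r)$. Then, for any $N\in\mathbb{N}$ and constants $\{\alpha_j\}_{1\le j\le N+1}$, $$\|K-K_{N+1}\|_{L^1}\le\frac{2\pi^{n/2}}{\Gamma(n/2)}\max_{\lambda\in[0,1]}|h(\lambda)-P_N(\lambda)|$$ holds, where $K_{N+1}=\sum_{j=1}^{N+1}\alpha_jk_j$ and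 $P_N$ is the polynomial $$P_N(\lambda):=\sum_{j=0}^N\alpha_{j+1}c_{j,n}\lambda^j,\qquad c_{j,1}:=\frac{j+1}{2},\quad c_{j,2}:=\frac{(j+1)^2}{2\pi},\quad c_{j,3}:=\frac{(j+1)^2}{4\pi}.$$
   Context: For $d_j=j^{-2}$ the Green functions $k_j$ of $-d_j\Delta+1$ on $\mathbb{R}^n$ are: $k_j(x)=\frac j2e^{-j|x|}$ if $n=1$; $k_j(x)=\frac{j^2}{2\pi}M_0(j|x|)$ if $n=2$; $k_j(x)=\frac{j^2}{4\pi|x|}e^{-j|x|}$ if $n=3$. Here $M_0(r)=\int_0^{+\infty}e^{-r\cosh s}\,ds$ is the modified Bessel function of the second kind of order $0$. When $n=2$, the value $A(0)$ is understood as $\lim_{r\to+0}A(r)=0$, so $h(1)=0$. *)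

(* Defs.v *)
From HB Require Import structures.
From mathcomp Require Export all_boot all_order all_algebra.
From mathcomp Require Export all_classical all_reals all_analysis.

Set Implicit Arguments.
Unset Strict Implicit.
Unset Printing Implicit Defensive.

Export Order.TTheory GRing.Theory Num.Theory.
Export numFieldNormedType.Exports.

Local Open Scope classical_set_scope.
Local Open Scope ring_scope.

(* R^n is n.-tuple R with the product of the Borel sigma-algebras; matrices
   are not used because their library norm is the max norm. *)
Notation Rn R n := (n.-tuple (measurableTypeR R)).

Section lebesgue_measure_Rn.
Context {R : realType}.

Definition tuple_of_prod n (z : Rn R n * measurableTypeR R) : Rn R n.+1 :=
  [tuple of z.2 :: z.1].

Lemma measurable_tuple_of_prod n :
  measurable_fun [set: Rn R n * measurableTypeR R] (@tuple_of_prod n).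
Proof. exact: measurable_cons. Qed.

HB.instance Definition _ n :=
  isMeasurableFun.Build _ _ _ _ (@tuple_of_prod n) (@measurable_tuple_of_prod n).

Section step.
Variables (n : nat) (m : {measure set (Rn R n) -> \bar R}).
Local Open Scope ereal_scope.

Definition lebesgue_step : set (Rn R n.+1) -> \bar R :=
  pushforward (m \x @lebesgue_measure R) (@tuple_of_prod n).

Let lebesgue_step0 : lebesgue_step set0 = 0.
Proof. exact: measure0. Qed.

Let lebesgue_step_ge0 A : 0 <= lebesgue_step A.
Proof. exact: measure_ge0. Qed.

Let lebesgue_step_sigma_additive : semi_sigma_additive lebesgue_step.
Proof. exact: measure_semi_sigma_additive. Qed.

HB.instance Definition _ := isMeasure.Build _ _ _ lebesgue_step
  lebesgue_step0 lebesgue_step_ge0 lebesgue_step_sigma_additive.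
End step.

Fixpoint lebesgueRn n : {measure set (Rn R n) -> \bar R} :=
  match n with
  | 0 => \d_([tuple] : Rn R 0)
  | n'.+1 => lebesgue_step (lebesgueRn n')
  end.

Definition enorm n (x : Rn R n) : R := Num.sqrt (\sum_(i < n) tnth x i ^+ 2).

End lebesgue_measure_Rn.

Section kernels.
Context {R : realType}.
Local Notation mu := (@lebesgue_measure R).
Implicit Types (J : R -> R) (r l x : R) (n j N : nat).

Definition Gamma x : R :=
  \int[mu]_(t in `]0, +oo[) (t `^ (x - 1) * expR (- t)).

Definition cosh x : R := (expR x + expR (- x)) / 2.

Definition M0 r : R := \int[mu]_(s in `[0, +oo[) expR (- (r * cosh s)).

(* Radial profile of the Green function k_j of - j^-2 Delta + 1 on R^n.  For
   n = 2, 3 its value at r = 0, where k_j is singular, is irrelevant. *)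
Definition green n j r : R :=
  match n with
  | 1 => j%:R / 2 * expR (- (j%:R * r))
  | 2 => j%:R ^+ 2 / (2 * pi) * M0 (j%:R * r)
  | 3 => j%:R ^+ 2 / (4 * pi * r) * expR (- (j%:R * r))
  | _ => 0
  end.

Definition coef n j : R :=
  match n with
  | 1 => j.+1%:R / 2
  | 2 => j.+1%:R ^+ 2 / (2 * pi)
  | 3 => j.+1%:R ^+ 2 / (4 * pi)
  | _ => 0
  end.

(* A profile J : R -> R stands for a function on [0, +oo[ (or on ]0, +oo[ when
   n = 3): no definition below looks at J outside of that domain.  In
   particular derivatives are taken relatively to [0, +oo[, so that the one at
   0 is the right derivative. *)
Definition half_quotient J r x : R := (J x - J r) / (x - r).

Definition half_derivable J r : Prop :=
  cvg (half_quotient J r x @[x --> within `[0, +oo[ r^']).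

Definition half_derive J r : R :=
  lim (half_quotient J r x @[x --> within `[0, +oo[ r^']).

Definition C1_half J : Prop :=
  (forall r, 0 <= r -> half_derivable J r) /\
  {within `[0, +oo[, continuous (half_derive J)}.

Definition kernel_assumption n J : Prop :=
  match n with
  | 1 => {within `[0, +oo[, continuous J} /\
         cvg (expR r * J r @[r --> +oo])
  | 2 => C1_half J /\
         exists2 a : R, 1 / 2 < a &
           cvg (r `^ a * expR r * half_derive J r @[r --> +oo])
  | 3 => [/\ {within `]0, +oo[, continuous J},
             cvg (r * J r @[r --> 0^'+]) &
             cvg (r * expR r * J r @[r --> +oo])]
  | _ => False
  end.

(* The function A of the case n = 2; the integral may diverge at r = 0, where A
   is understood as its limit (see hfun). *)
Definition abel J r : R :=
  - (2 * r / pi) * \int[mu]_(s in `[0, +oo[) half_derive J (r * cosh s).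

Definition hfun n J l : R :=
  match n with
  | 1 => if l == 0 then lim (expR r * J r @[r --> +oo])
         else J (- ln l) / l
  | 2 => if l == 0 then lim (expR r * abel J r @[r --> +oo])
         else if l == 1 then lim (abel J r @[r --> 0^'+])
         else abel J (- ln l) / l
  | 3 => if l == 0 then lim (r * expR r * J r @[r --> +oo])
         else if l == 1 then lim (r * J r @[r --> 0^'+])
         else - ln l * J (- ln l) / l
  | _ => 0
  end.

Definition approx_poly n N (alpha : nat -> R) : {poly R} :=
  \poly_(j < N.+1) (alpha j.+1 * coef n j).

(* alpha is indexed from 1; approx_kernel n m alpha is K_m. *)
Definition approx_kernel n m (alpha : nat -> R) (x : Rn R n) : R :=
  \sum_(1 <= j < m.+1) alpha j * green n j (enorm x).

Definition is_maximum (A : set R) (M : R) : Prop := A M /\ ubound A M.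

End kernels.

(* Main.v *)
From HB Require Import structures.
From mathcomp Require Import measurable_realfun ring lra.
Require Import Defs.

(** Put [l = expR (- r)].  For [n = 1, 2, 3] let [B r] be [J r], [abel J r] and
    [r * J r] respectively: then [hfun n J l = B (- ln l) / l] for [0 < l < 1],
    and the same operation turns the profile of the [j]-th Green function into
    [coef n j.-1 * expR (- (j%:R * r))].  Hence [hfun n J l - P l], with [P] the
    polynomial [approx_poly n N alpha], is [expR r] times the error made when [B]
    is approximated by a sum of exponentials.  The hypotheses on [J] make
    [hfun n J] continuous up to the endpoints [l = 0] ([r] infinite) and [l = 1]
    ([r = 0]), so the maximum [M] exists ([max_error_exp]) and the error
    on [B] is at most [M * expR (- r)] ([weighted_error]).

    Going back from [B] to [J] is a linear operation with a positive kernel, so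
    the error on [J] is at most [M * W r], where [W r] is the image of
    [expR (- r)]: it is [expR (- r)], [M0 r] and [expR (- r) / r] respectively.
    By polar coordinates ([ge0_integral_radial]) the integral of [W] over [R^n] is
    the area of the unit sphere times that of [W r * r ^+ n.-1] over the
    half-line, which is [1] ([integral_expN], [integral_M0],
    [integral_mul_expNM]).  This gives the constant ([approx_error_le]).

    Polar coordinates come from scaling: the ball of radius [s] has volume
    [V * s ^+ n], so the map [V * enorm x ^+ n] pushes the measure of [R^n] to that
    of the half-line.  The integral of the Gaussian, computed both as a product
    and in polar coordinates, identifies the constant [n * V]
    ([sphere_areaE]).

    For [n = 2] the operation from [B] to [J] is
    [J r = \int[mu]_(t in `[0, +oo[) abel J (r * cosh t)] ([abel_inversion]).
    Writing [abel J] as an integral over [s] and putting [p = sinh t] and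
    [q = cosh t * sinh s], the double integral becomes that of a radial function
    over a quarter of the plane; in polar coordinates it is the integral of [- J']
    from [r] to infinity.  That is [J r], because [J] has a limit at infinity,
    which vanishes as [K] is integrable.  The behaviour of [abel J] at both ends
    follows from the bound [M0_le] on [M0]; at infinity it leaves
    [r `^ (1 / 2 - a)], which explains the condition on the exponent. *)

Set Implicit Arguments.
Unset Strict Implicit.
Unset Printing Implicit Defensive.

Local Open Scope classical_set_scope.
Local Open Scope ring_scope.

(** * Integration by substitution on a half-line *)

Section substitution.
Context {R : realType}.
Local Notation mu := (@lebesgue_measure R).

Lemma measurable_funoy (f : R -> R) (b : R) : {in `]b, +oo[, continuous f} ->
  measurable_fun `]b, +oo[ f.
Proof.
move=> cf; apply: open_continuous_measurable_fun; first exact: interval_open.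
by move=> x /[!inE]/= /cf.
Qed.

(** Only compact subintervals [[(k.+1)^-1, k.+1]] are substituted; the integrals
    over them increase to both sides.  So neither [F'] nor [G] has to be bounded
    near the ends, as is needed for [sinh] and for singular profiles. *)
Lemma ge0_integral_subst_oy (F F' G : R -> R) (b : R) :
  (forall x : R, 0 < x -> is_derive x 1 F (F' x)) ->
  (forall x, 0 < x -> 0 < F' x) ->
  {in `]0, +oo[, continuous F'} ->
  F x @[x --> 0^'+] --> b -> F x @[x --> +oo] --> +oo ->
  {in `]b, +oo[, continuous G} -> (forall x, b < x -> 0 <= G x) ->
  (\int[mu]_(x in `]b, +oo[) (G x)%:E =
   \int[mu]_(x in `]0%R, +oo[) (G (F x) * F' x)%:E)%E.
Proof.
move=> dF F'0 cF' Fb Fy cG G0.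
have cF (x : R) : 0 < x -> {for x, continuous F}.
  by move=> /dF dFx; apply/differentiable_continuous/derivable1_diffP.
have incF x y : 0 < x -> x < y -> F x < F y.
  move=> x0 xy.
  have [|/= c|c] := @MVT _ F F' x y xy.
  - by move=> z /[!in_itv]/= /andP[xz _]; apply: dF; exact: lt_trans xz.
  - apply: continuous_in_subspaceT => z /[!inE]/= /[!in_itv]/= /andP[xz _].
    by apply: cF; exact: lt_le_trans xz.
  rewrite in_itv/= => /andP[xc _] FF.
  by rewrite -subr_gt0 FF mulr_gt0 ?subr_gt0// F'0// (lt_trans x0).
have Fgtb x : 0 < x -> b < F x.
  move=> x0; have x20 : 0 < x / 2 by rewrite divr_gt0.
  apply: (@le_lt_trans _ _ (F (x / 2))); last by apply: incF => //; lra.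
  apply: (cvgr_to_le Fb); near=> y; apply/ltW/incF; first by [].
  by near: y; exact: nbhs_right_lt.
pose a_ k : R := k.+1%:R^-1.
pose b_ k : R := k.+1%:R.
have a0 k : 0 < a_ k by rewrite invr_gt0.
have ab k : a_ k <= b_ k.
  by rewrite /a_ /b_ (@le_trans _ _ 1)// ?invf_le1// ler1n.
have cGF : {in `]0, +oo[, continuous (fun x => G (F x) * F' x)}.
  move=> x x0; apply: continuousM; last exact: cF'.
  move: x0; rewrite in_itv/= andbT => x0.
  by apply: continuous_comp; [exact: cF|apply: cG; rewrite in_itv/= Fgtb].
have GF0 x : 0 < x -> 0 <= G (F x) * F' x.
  by move=> x0; rewrite mulr_ge0 ?G0 ?Fgtb// ltW// F'0.
have E_k k : (\int[mu]_(x in `[F (a_ k), F (b_ k)]) (G x)%:E =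
             \int[mu]_(x in `[a_ k, b_ k]) (G (F x) * F' x)%:E)%E.
  have F'E (x : R) : 0 < x -> F^`()%classic x = F' x.
    by move=> x0; rewrite derive1E; have /@derive_val := dF _ x0.
  have F'near (x : R) : 0 < x -> \forall y \near x, F^`()%classic y = F' y.
    by move=> x0; near=> y; apply: F'E; near: y; exact: lt_nbhsr.
  have cF1 (x : R) : 0 < x -> {for x, continuous F^`()%classic}.
    move=> x0; rewrite /prop_for /continuous_at F'E//.
    apply: (@cvg_trans _ (F' y @[y --> x])).
      by apply: near_eq_cvg; have := F'near _ x0; apply: filterS => y ->.
    by apply: cF'; rewrite in_itv/= x0.
  rewrite integration_by_substitution_increasing//.
  - apply: eq_integral => x /[!inE]/= /[!in_itv]/= /andP[ax _].
    by rewrite /= fctE F'E// (lt_le_trans (a0 k)).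
  - move=> x y /[!in_itv]/= /andP[ax _] _; apply: incF.
    exact: lt_le_trans ax.
  - by move=> x /[!in_itv]/= /andP[ax _]; apply: cF1; exact: lt_trans ax.
  - apply/cvg_ex; exists (F^`()%classic (a_ k)).
    by apply: cvg_at_right_filter; exact: cF1.
  - apply/cvg_ex; exists (F^`()%classic (b_ k)).
    by apply: cvg_at_left_filter; apply: cF1; exact: (lt_le_trans (a0 k)).
  - split.
    + move=> x /[!in_itv]/= /andP[ax _].
      by have /@ex_derive := dF _ (lt_trans (a0 k) ax).
    + by apply: cvg_at_right_filter; exact: cF.
    + by apply: cvg_at_left_filter; apply: cF; exact: (lt_le_trans (a0 k)).
  - apply: continuous_in_subspaceT => x /[!inE]/= /[!in_itv]/= /andP[ax _].
    by apply: cG; rewrite in_itv/= (lt_le_trans _ ax)// Fgtb.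
have decra k l : (k <= l)%N -> a_ l <= a_ k.
  by move=> kl; rewrite lef_pV2 ?posrE// ler_nat ltnS.
have incrb k l : (k <= l)%N -> b_ k <= b_ l.
  by move=> kl; rewrite ler_nat ltnS.
have lehomo x y : 0 < x -> x <= y -> F x <= F y.
  by move=> x0; rewrite le_eqVlt => /predU1P[->//|xy]; exact/ltW/incF.
have -> : `]b, +oo[%classic = \bigcup_k `[F (a_ k), F (b_ k)]%classic.
  apply/seteqP; split => [y/=|y [k _]/=]; rewrite !in_itv/= ?andbT; last first.
    by move=> /andP[+ _]; apply: lt_le_trans; exact: Fgtb.
  move=> bY.
  have [e /= e0 He] : \forall x \near 0^'+, F x < y.
    by move/cvgr_lt : Fb; exact.
  have [M [_ HM]] : \forall x \near +oo, y <= F x by move/cvgryPge : Fy; exact.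
  have [k ke] : exists k, a_ k < e.
    exists (Num.truncn e^-1); rewrite /a_ invf_plt ?posrE//; exact: truncnS_gt.
  have [l lM] : exists l, M < b_ l by exists (Num.truncn M); exact: truncnS_gt.
  exists (maxn k l) => //=; rewrite in_itv/=; apply/andP; split.
    apply: ltW; apply: He => //=.
    rewrite sub0r normrN gtr0_norm//; apply: le_lt_trans ke.
    by apply: decra; exact: leq_maxl.
  by apply: HM; apply: (lt_le_trans lM); apply: incrb; exact: leq_maxr.
have E0 : `]0, +oo[%classic = \bigcup_k `[a_ k, b_ k]%classic.
  apply/seteqP; split => [y/=|y [k _]/=]; rewrite !in_itv/= ?andbT; last first.
    by move=> /andP[+ _]; apply: lt_le_trans.
  move=> y0; exists (maxn (Num.truncn y^-1) (Num.truncn y)) => //=; rewrite in_itv/=; apply/andP; split.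
    apply: (@le_trans _ _ (a_ (Num.truncn y^-1))); first by apply: decra; exact: leq_maxl.
    rewrite /a_ invf_ple ?posrE//; exact/ltW/truncnS_gt.
  apply: (@le_trans _ _ (b_ (Num.truncn y))); last by apply: incrb; exact: leq_maxr.
  exact/ltW/truncnS_gt.
rewrite E0.
have H1 : (\int[mu]_(x in `[F (a_ k), F (b_ k)]) (G x)%:E @[k --> \oo] -->
  \int[mu]_(x in \bigcup_k `[F (a_ k), F (b_ k)]%classic) (G x)%:E)%E.
  apply: ge0_nondecreasing_set_cvg_integral.
  - move=> k l kl; apply/subsetPset => x /=; rewrite !in_itv/= => /andP[h1 h2].
    rewrite (le_trans _ h1) ?(le_trans h2)//.
    + by apply: lehomo; [exact: lt_le_trans (ab _)|exact: incrb].
    + by apply: lehomo => //; exact: decra.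
  - by move=> k; exact: measurable_itv.
  - move=> k; apply/measurable_EFinP.
    apply: (measurable_funS _ _ (measurable_funoy cG)) => // x /=.
    by rewrite !in_itv/= andbT => /andP[+ _]; apply: lt_le_trans; exact: Fgtb.
  - move=> k x /=; rewrite in_itv/= lee_fin => /andP[h _]; apply: G0.
    by apply: lt_le_trans h; exact: Fgtb.
have H2 : (\int[mu]_(x in `[a_ k, b_ k]) (G (F x) * F' x)%:E @[k --> \oo] -->
  \int[mu]_(x in \bigcup_k `[a_ k, b_ k]%classic) (G (F x) * F' x)%:E)%E.
  apply: ge0_nondecreasing_set_cvg_integral.
  - move=> k l kl; apply/subsetPset => x /=; rewrite !in_itv/= => /andP[h1 h2].
    by rewrite (le_trans _ h1) ?(le_trans h2)// ?incrb// decra.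
  - by move=> k; exact: measurable_itv.
  - move=> k; apply/measurable_EFinP.
    apply: (measurable_funS _ _ (measurable_funoy cGF)) => // x /=.
    by rewrite !in_itv/= andbT => /andP[+ _]; apply: lt_le_trans.
  - move=> k x /=; rewrite in_itv/= lee_fin => /andP[h _]; apply: GF0.
    exact: lt_le_trans h.
rewrite (eq_cvg _ _ E_k) in H1.
exact: cvg_unique H1 H2.
Unshelve. all: by end_near. Qed.

End substitution.

(** * Lebesgue measure on the Euclidean space *)

Section sigma_finite_pack.
Context d (T : measurableType d) (R : realType) (m : {measure set T -> \bar R}).

(** [m] itself, with a proof that it is sigma-finite as an argument for
    canonical inference to find. *)
Definition sigma_finite_pack (_ : sigma_finite setT m) : set T -> \bar R := m.

HB.instance Definition _ (mT : sigma_finite setT m) :=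
  Measure.copy (sigma_finite_pack mT) m.
HB.instance Definition _ (mT : sigma_finite setT m) :=
  Measure_isSigmaFinite.Build _ _ _ (sigma_finite_pack mT) mT.

End sigma_finite_pack.

(** The pushforward as a bundled measure: measurability of [f] is an argument,
    so that [f] need not be bundled. *)
Definition image_measure d1 d2 (T1 : measurableType d1) (T2 : measurableType d2)
    (R : realType) (m : {measure set T1 -> \bar R}) (f : T1 -> T2)
    (mf : measurable_fun setT f) : {measure set T2 -> \bar R} :=
  measure_function_pushforward__canonical__measure_function_Measure m mf.

Section Rn.
Context {R : realType}.
Local Notation mu := (@lebesgue_measure R).

Lemma measurable_thead n : measurable_fun [set: Rn R n.+1] (fun x => thead x).
Proof. exact: measurable_tnth. Qed.

Lemma measurable_tbehead n :
  measurable_fun [set: Rn R n.+1] (fun x => [tuple of behead x] : Rn R n).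
Proof.
apply/measurable_fun_tnthP => i.
rewrite (_ : _ \o _ = fun x : Rn R n.+1 => tnth x (lift ord0 i)).
  exact: measurable_tnth.
by apply/funext => x /=; rewrite tnth_behead; congr tnth; apply/val_inj;
  rewrite /= inordK// ltnS.
Qed.

Lemma tuple_of_prodK n : cancel (@tuple_of_prod R n)
  (fun x : Rn R n.+1 => ([tuple of behead x], thead x)).
Proof. by move=> [x y]; rewrite /tuple_of_prod/= theadE; congr pair; apply: val_inj. Qed.

(** Tonelli's theorem asks for sigma-finiteness.  The step of the induction pulls
    products of sets of finite measure back to tuples. *)
Lemma sigma_finite_lebesgueRn n : sigma_finite setT (@lebesgueRn R n).
Proof.
elim: n => [|n ih].
  exists (fun=> setT) => [|i]; first by rewrite bigcup_const.
  by split => //=; rewrite diracT ltry.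
pose m : {sigma_finite_measure set (Rn R n) -> \bar R} :=
  sigma_finite_pack ih.
have /sigma_finiteP[F [FT ndF Foo]] := sigma_finiteT m.
have /sigma_finiteP[G [GT ndG Goo]] := sigma_finiteT (@lebesgue_measure R).
pose g (x : Rn R n.+1) : Rn R n * measurableTypeR R := ([tuple of behead x], thead x).
have mg : measurable_fun setT g.
  by apply/measurable_fun_pairP; split; [exact: measurable_tbehead|exact: measurable_thead].
exists (fun k => g @^-1` (F k `*` G k)) => [|k].
  apply/esym; rewrite -subTset => x _; rewrite -preimage_bigcup/=.
  have : [set: Rn R n] (g x).1 by []. rewrite FT => -[k _ Fk].
  have : [set: measurableTypeR R] (g x).2 by []. rewrite GT => -[l _ Gl].
  exists (maxn k l) => //; split.
  - by move: Fk; exact/subsetPset/ndF/leq_maxl.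
  - by move: Gl; exact/subsetPset/ndG/leq_maxr.
have [mF Fkoo] := Foo k; have [mG Gkoo] := Goo k; split.
  by rewrite -[X in measurable X]setTI; apply: mg => //; exact: measurableX.
rewrite /= /lebesgue_step /pushforward/= -comp_preimage (_ : g \o _ = id).
  by rewrite preimage_id product_measure1E// lte_mul_pinfty// ge0_fin_numE.
by apply/funext => x; exact: tuple_of_prodK.
Qed.

Definition sf_lebesgueRn n : {sigma_finite_measure set (Rn R n) -> \bar R} :=
  sigma_finite_pack (@sigma_finite_lebesgueRn n).

Local Open Scope ereal_scope.

Lemma ge0_integral_lebesgueRnS n (f : Rn R n.+1 -> \bar R) :
  measurable_fun [set: Rn R n.+1] f -> (forall x, 0 <= f x) ->
  \int[lebesgueRn n.+1]_x f x =
  \int[lebesgueRn n]_z \int[mu]_y f (tuple_of_prod (z, y)).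
Proof.
move=> mf f0; rewrite [LHS]ge0_integral_pushforward// preimage_setT.
have mf' := measurableT_comp mf (@measurable_tuple_of_prod R n).
exact: (@fubini_tonelli1 _ _ _ _ R (sf_lebesgueRn n) (@lebesgue_measure R)
  _ mf' (fun z => f0 _)).
Qed.

Lemma measurable_fun_inner n (f : Rn R n.+1 -> \bar R) :
  measurable_fun [set: Rn R n.+1] f -> (forall x, 0 <= f x) ->
  measurable_fun [set: Rn R n] (fun z => \int[mu]_y f (tuple_of_prod (z, y))).
Proof.
move=> mf f0.
apply: (measurable_fun_fubini_tonelli_F (f \o @tuple_of_prod R n)) => //=.
exact: (measurableT_comp mf (@measurable_tuple_of_prod _ _)).
Qed.

(** The preimage of an interval under multiplication by [c] is [c] times shorter,
    and intervals determine the pushforward. *)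
Lemma ge0_integral_scale (c : R) (f : R -> \bar R) : (0 < c)%R ->
  measurable_fun setT f -> (forall x, 0 <= f x) ->
  \int[mu]_x f (c * x)%R = c^-1%:E * \int[mu]_x f x.
Proof.
move=> c0 mf f0.
pose phi (x : measurableTypeR R) : measurableTypeR R := (c * x)%R.
have mphi : measurable_fun setT phi by exact: measurable_funM.
pose m : {measure set (measurableTypeR R) -> \bar R} :=
  mscale (NngNum (ltW c0)) (image_measure mu mphi).
have muE : forall A, measurable A -> mu A = m A.
  apply: lebesgue_measure_unique => //= _ [[a b]] _ <-.
  rewrite /m /mscale/= /pushforward/=.
  rewrite (_ : phi @^-1` _ = `](a / c)%R, (b / c)%R]%classic); last first.
    by apply/seteqP; split => x /=; rewrite !in_itv/= ltr_pdivrMr// ler_pdivlMr// /phi (mulrC c).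
  rewrite !lebesgue_measure_itv/= !lte_fin ltr_pM2r ?invr_gt0//.
  case: ifPn => _; last by rewrite mule0.
  by rewrite -!EFinD -EFinM -mulrBl mulrC divfK// gt_eqF.
rewrite [in RHS](eq_measure_integral m) => [|A mA _]; last exact: muE.
rewrite ge0_integral_mscale//= muleA -EFinM mulVf ?gt_eqF// mul1e.
rewrite ge0_integral_pushforward//.
Qed.

Definition scaleRn n (c : R) (x : Rn R n) : Rn R n := [tuple (c * tnth x i)%R | i < n].

Lemma measurable_scaleRn n c : measurable_fun setT (@scaleRn n c).
Proof.
apply/measurable_fun_tnthP => i.
rewrite (_ : _ \o _ = fun x : Rn R n => (c * tnth x i)%R).
  by apply: measurable_funM => //; exact: measurable_tnth.
by apply/funext => x; rewrite /= tnth_mktuple.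
Qed.

Lemma scaleRn_tuple_of_prod n c (z : Rn R n) y :
  scaleRn c (tuple_of_prod (z, y)) = tuple_of_prod (scaleRn c z, (c * y)%R).
Proof.
apply/eq_from_tnth => i; rewrite tnth_mktuple.
by case: (unliftP ord0 i) => [j|] ->; rewrite /tuple_of_prod/= ?tnthS ?tnth_mktuple ?tnth0.
Qed.

Lemma ge0_integral_scaleRn n (c : R) (f : Rn R n -> \bar R) : (0 < c)%R ->
  measurable_fun [set: Rn R n] f -> (forall x, 0 <= f x) ->
  \int[lebesgueRn n]_x f (scaleRn c x) = (c^-1 ^+ n)%:E * \int[lebesgueRn n]_x f x.
Proof.
move=> c0; elim: n f => [|n ih] f mf f0.
  rewrite expr0 mul1e; apply: eq_integral => x _; congr f.
  by rewrite (tuple0 x) (tuple0 (scaleRn _ _)).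
rewrite !ge0_integral_lebesgueRnS//; last first.
  by apply: measurableT_comp => //; exact: measurable_scaleRn.
under eq_integral => z _.
  under eq_integral do rewrite scaleRn_tuple_of_prod.
  rewrite (@ge0_integral_scale _ (fun y => f (tuple_of_prod (scaleRn c z, y))))//; last first.
    have mt := @measurable_tuple_of_prod R n.
    exact: (measurableT_comp mf (measurableT_comp mt (pair1_measurable _))).
  over.
rewrite ge0_integralZl//; last 3 first.
- apply: (measurableT_comp (measurable_fun_inner mf f0)); exact: measurable_scaleRn.
- by move=> z _; exact: integral_ge0.
- by rewrite lee_fin invr_ge0 ltW.
rewrite (ih (fun z => \int[mu]_y f (tuple_of_prod (z, y))))//; last 2 first.
- exact: measurable_fun_inner.
- by move=> z; exact: integral_ge0.
by rewrite muleA -EFinM exprS.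
Qed.

Lemma enormE n (x : Rn R n) : (enorm x ^+ 2 = \sum_(i < n) tnth x i ^+ 2)%R.
Proof. by rewrite sqr_sqrtr// sumr_ge0// => i _; exact: sqr_ge0. Qed.

Lemma enorm_ge0 n (x : Rn R n) : (0 <= enorm x)%R.
Proof. exact: sqrtr_ge0. Qed.

Lemma sqr_enormS n (z : Rn R n) y :
  (enorm (tuple_of_prod (z, y)) ^+ 2 = y ^+ 2 + enorm z ^+ 2)%R.
Proof.
rewrite !enormE big_ord_recl tnth0; congr +%R.
by apply: eq_bigr => i _; rewrite tnthS.
Qed.

Lemma enorm_scaleRn n c (x : Rn R n) : (0 <= c)%R -> enorm (scaleRn c x) = (c * enorm x)%R.
Proof.
move=> c0; rewrite /enorm -[X in (X * _)%R](ger0_norm c0) -sqrtr_sqr -sqrtrM ?sqr_ge0//.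
by rewrite mulr_sumr; congr Num.sqrt; apply: eq_bigr => i _; rewrite tnth_mktuple exprMn.
Qed.

Lemma measurable_enorm n : measurable_fun setT (@enorm R n).
Proof.
have ms : measurable_fun setT (@Num.sqrt R).
  by apply: continuous_measurable_fun; exact: sqrt_continuous.
apply: (measurableT_comp ms); apply: measurable_sum => i.
by apply: measurable_funX; exact: measurable_tnth.
Qed.

(** [expR (- enorm x ^+ 2)] is a product of functions of one coordinate. *)
Lemma integral_gaussRn n :
  \int[lebesgueRn n]_x (@gauss_fun R (enorm x))%:E = (Num.sqrt pi ^+ n)%:E.
Proof.
have mg k : measurable_fun [set: Rn R k] (fun x => (@gauss_fun R (enorm x))%:E).
  apply/measurable_EFinP.
  exact: (measurableT_comp (@measurable_gauss_fun R) (@measurable_enorm k)).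
have g0 x : 0 <= (@gauss_fun R x)%:E by rewrite lee_fin gauss_fun_ge0.
elim: n => [|n ih].
  rewrite integral_dirac//; last exact: mg.
  rewrite diracT mul1e /gauss_fun /enorm big_ord0 sqrtr0.
  by rewrite expr0n/= oppr0 expR0 expr0.
rewrite ge0_integral_lebesgueRnS//.
under eq_integral => z _.
  under eq_integral do rewrite /gauss_fun sqr_enormS opprD expRD EFinM.
  rewrite ge0_integralZr//; last first.
  - by apply/measurable_EFinP; exact: measurable_gauss_fun.
  rewrite integralT_gauss; over.
rewrite ge0_integralZl//; last exact: mg.
by rewrite ih -EFinM exprS.
Qed.

End Rn.

(** * Polar coordinates: the volumes of balls *)

Section polar.
Context {R : realType}.
Local Notation mu := (@lebesgue_measure R).

Definition oball n (s : R) : set (Rn R n) := [set x | enorm x < s].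
Arguments oball : clear implicits.

Lemma measurable_enorm_preimage n (A : set R) : measurable A ->
  measurable (@enorm R n @^-1` A).
Proof. by move=> mA; rewrite -[X in measurable X]setTI; exact: measurable_enorm. Qed.

Lemma oballE n s : oball n s = @enorm R n @^-1` `]-oo, s[.
Proof. by apply/seteqP; split => x /=; rewrite in_itv. Qed.

Lemma measurable_oball n s : measurable (oball n s).
Proof. rewrite oballE; exact: measurable_enorm_preimage. Qed.

Lemma measure_oball n (s : R) : 0 < s ->
  (lebesgueRn n (oball n s) = (s ^+ n)%:E * lebesgueRn n (oball n 1))%E.
Proof.
move=> s0; have mb t := @measurable_oball n t.
have indE t : (lebesgueRn n (oball n t) = \int[lebesgueRn n]_x (\1_(oball n t) x)%:E)%E.
  by rewrite integral_indic// setIT.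
rewrite !indE -[s in (s ^+ n)%R]invrK -ge0_integral_scaleRn ?invr_gt0//.
- apply: eq_integral => x _; rewrite !indicE; congr ((nat_of_bool _)%:R%:E).
  apply/idP/idP; rewrite !inE /oball/= enorm_scaleRn ?invr_ge0 ?ltW// mulrC.
    by rewrite ltr_pdivrMr// mul1r.
  by rewrite ltr_pdivrMr// mul1r.
- by apply/measurable_EFinP; exact: measurable_indic.
Qed.

(** On the unit ball the Gaussian is at least [expR (- 1)]. *)
Lemma measure_oball1_lty n : (lebesgueRn n (oball n 1) < +oo)%E.
Proof.
have mb := @measurable_oball n 1.
have mg : measurable_fun [set: Rn R n] (fun x => (@gauss_fun R (enorm x))%:E).
  apply/measurable_EFinP.
  exact: (measurableT_comp (@measurable_gauss_fun R) (@measurable_enorm R n)).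
have : ((expR (-1))%:E * lebesgueRn n (oball n 1) <= (Num.sqrt pi ^+ n)%:E)%E.
  rewrite -integral_gaussRn -[X in (_ * lebesgueRn n X)%E](setIT) -integral_indic//.
  rewrite -ge0_integralZl//; last first.
  + by apply/measurable_EFinP; exact: measurable_indic.
  + apply: ge0_le_integral => //.
    * by apply: measurable_funeM; apply/measurable_EFinP; exact: measurable_indic.
    * move=> x _; rewrite -EFinM lee_fin indicE.
      have [|_] := boolP (x \in oball n 1); last by rewrite mulr0 expR_ge0.
      rewrite inE /oball/= mulr1 => x1; rewrite ler_expR lerN2.
      by apply: exprn_ile1; [exact: enorm_ge0|exact: ltW].
rewrite ltNge; apply: contraL; rewrite leye_eq => /eqP ->.
by rewrite gt0_muley ?lte_fin ?expR_gt0// -ltNge ltry.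
Qed.

Definition ball_vol n : R := fine (lebesgueRn n (oball n 1)).

Lemma ball_vol_ge0 n : 0 <= ball_vol n.
Proof. exact/fine_ge0/measure_ge0. Qed.

Lemma measure_oballE n (s : R) : 0 < s ->
  lebesgueRn n (oball n s) = (ball_vol n * s ^+ n)%:E.
Proof.
move=> s0; rewrite measure_oball// mulrC EFinM fineK//.
by rewrite ge0_fin_numE ?measure_ge0// measure_oball1_lty.
Qed.

(** Otherwise all balls, hence the whole space, would be negligible, and the
    Gaussian would have integral zero. *)
Lemma ball_vol_gt0 n : 0 < ball_vol n.
Proof.
rewrite lt0r ball_vol_ge0 andbT; apply/eqP => V0.
have : (lebesgueRn n).-negligible (\bigcup_k oball n k.+1%:R).
  apply: negligible_bigcup => k; apply/negligibleP; first exact: measurable_oball.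
  by apply: (etrans (measure_oballE _ _)) => //; rewrite V0 mul0r.
have -> : \bigcup_k oball n k.+1%:R = setT.
  apply/seteqP; split => // x _; exists (Num.truncn (enorm x)) => //.
  exact: truncnS_gt.
move=> /negligibleP -/(_ measurableT) T0.
have := @integral_gaussRn R n.
rewrite null_set_integral//.
  by move=> -[] /esym/eqP; rewrite gt_eqF// exprn_gt0// sqrtr_gt0 pi_gt0.
apply/measurable_EFinP.
exact: (measurableT_comp (@measurable_gauss_fun R) (@measurable_enorm R n)).
Qed.

Lemma measure_enorm_le0 n : (0 < n)%N ->
  lebesgueRn n [set x : Rn R n | enorm x <= 0] = 0%E.
Proof.
move=> n0.
have mE : measurable ([set x | enorm x <= 0] : set (Rn R n)).
  rewrite (_ : [set _ | _] = @enorm R n @^-1` `]-oo, 0]).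
    exact: measurable_enorm_preimage.
  by apply/seteqP; split => x /=; rewrite in_itv.
apply/eqP; rewrite eq_le measure_ge0 andbT; apply/lee_addgt0Pr => e e0.
rewrite add0e; pose s := Num.min 1 (e / ball_vol n).
have V0 := ball_vol_gt0 n.
have s0 : 0 < s by rewrite lt_min ltr01 divr_gt0.
apply: (@le_trans _ _ (lebesgueRn n (oball n s))).
  apply: le_measure; rewrite ?inE//; first exact: measurable_oball.
  by move=> x /= x0; rewrite /oball/= (le_lt_trans x0).
rewrite measure_oballE// lee_fin -ler_pdivlMl// mulrC.
apply: (@le_trans _ _ s); last by rewrite ge_min lexx orbT.
case: n n0 {V0 mE} @s s0 => // n _ s s0.
by rewrite exprS ger_pMr//; apply: exprn_ile1; rewrite ?(ltW s0)// ge_min lexx.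
Qed.

Section image.
Variable n : nat.
Hypothesis n0 : (0 < n)%N.
Local Notation V := (ball_vol n).

Let T (x : Rn R n) : measurableTypeR R := V * enorm x ^+ n.

Let mT : measurable_fun setT T.
Proof.
by apply: measurable_funM => //; apply: measurable_funX; exact: measurable_enorm.
Qed.

Let mD : measurable (`[0, +oo[%classic : set (measurableTypeR R)).
Proof. exact: measurable_itv. Qed.

(** The set where [T < u] is the ball of volume [u], and the intervals [`]-oo, u[]
    determine a measure that is finite on them. *)
Let image_T A : measurable A -> image_measure (lebesgueRn n) mT A = mrestr mu mD A.
Proof.
move=> mA; apply: (@measure_unique _ R (measurableTypeR R) (@RGenInftyO.G R)
  (fun k => `]-oo, k%:R[%classic) _ _ _ _ _ _ _ _ A mA).
- exact: RGenInftyO.measurableE.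
- move=> _ _ [x ->] [y ->]; exists (Num.min x y).
  by apply/seteqP; split => z /=; rewrite !in_itv/= lt_min => /andP.
- by move=> k; exists k%:R.
- apply/seteqP; split => // x _; exists (Num.truncn x).+1 => //=.
  by rewrite in_itv/= truncnS_gt.
- move=> _ [u ->]; rewrite /image_measure/= /pushforward /mrestr.
  have [u0|u0] := leP u 0.
    rewrite (_ : T @^-1` _ = set0); last first.
      rewrite -subset0 => x /=; rewrite in_itv/= => xu.
      have := lt_le_trans xu u0; rewrite ltNge => /negP; apply.
      by rewrite mulr_ge0 ?ball_vol_ge0// exprn_ge0// enorm_ge0.
    rewrite (_ : _ `&` _ = set0) ?measure0//.
    rewrite -subset0 => x /= []; rewrite !in_itv/= andbT => xu x0.
    by have := le_lt_trans x0 (lt_le_trans xu u0); rewrite ltxx.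
  have V0 := ball_vol_gt0 n.
  (* the radius of the ball of volume [u] *)
  pose s := (u / V) `^ n%:R^-1.
  have s0 : 0 < s by rewrite powR_gt0// divr_gt0.
  have sn : s ^+ n = u / V.
    by rewrite -powR_mulrn ?ltW// -powRrM mulVf ?pnatr_eq0 -?lt0n// powRr1// divr_ge0 ?ltW.
  rewrite (_ : T @^-1` _ = oball n s); last first.
    apply/seteqP; split => x /=; rewrite in_itv/= /T /oball/= -ltr_pdivlMl// mulrC -sn.
      by rewrite ltr_pXn2r// ?nnegrE ?enorm_ge0// ltW.
    by rewrite ltr_pXn2r// ?nnegrE ?enorm_ge0// ltW.
  rewrite measure_oballE// sn mulrC divfK ?gt_eqF//.
  rewrite (_ : _ `&` _ = `[0, u[%classic); last first.
    by apply/seteqP; split => x /=; rewrite !in_itv/= andbT; [move=> [-> ->]|move=> /andP[-> ->]].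
  by rewrite lebesgue_measure_itv/= lte_fin u0 sube0.
- move=> k; rewrite /image_measure/= /pushforward.
  apply: (@le_lt_trans _ _ (lebesgueRn n (oball n ((k%:R / V) `^ n%:R^-1 + 1)))); last first.
    rewrite measure_oballE ?ltry//.
    by rewrite ltr_wpDl// powR_ge0.
  apply: le_measure; rewrite ?inE.
  - by rewrite -[X in measurable X]setTI; apply: mT => //; exact: measurable_itv.
  - exact: measurable_oball.
  - move=> x /=; rewrite in_itv/= /T /oball/= -ltr_pdivlMl ?ball_vol_gt0// mulrC => xk.
    apply: (@le_lt_trans _ _ ((k%:R / V) `^ n%:R^-1)); last by rewrite ltrDl.
    rewrite -(@ler_pXn2r _ n)// ?nnegrE ?enorm_ge0// ?powR_ge0//.
    rewrite -(powR_mulrn _ (powR_ge0 _ _)) -powRrM mulVf ?pnatr_eq0 -?lt0n// powRr1 ?(ltW xk)//.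
    by rewrite divr_ge0// ball_vol_ge0.
Qed.

(** Push forward under [T], then substitute [u = V * r ^+ n]. *)
Lemma ge0_integral_radial_vol (g : R -> R) : {in `]0, +oo[, continuous g} ->
  (forall r, 0 < r -> 0 <= g r) ->
  (\int[lebesgueRn n]_(x in [set x : Rn R n | (0 < enorm x)%R]) (g (enorm x))%:E =
   \int[mu]_(r in `]0%R, +oo[) (g r * (V * (n%:R * r ^+ n.-1)))%:E)%E.
Proof.
move=> cg g0; have V0 := ball_vol_gt0 n.
pose G u := g ((u / V) `^ n%:R^-1).
have GT r : 0 < r -> G (V * r ^+ n) = g r.
  move=> r0; rewrite /G mulrAC divff ?gt_eqF// mul1r -powR_mulrn ?(ltW r0)//.
  by rewrite -powRrM divff ?pnatr_eq0 -?lt0n// powRr1// ltW.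
have cG : {in `]0, +oo[, continuous G}.
  move=> u; rewrite in_itv/= andbT => u0.
  apply: (@continuous_comp _ _ _ (fun u : R => (u / V) `^ n%:R^-1) g); last first.
    by apply: cg; rewrite in_itv/= andbT powR_gt0// divr_gt0.
  apply: (@continuous_comp _ _ _ (fun u : R => u / V) (fun y => y `^ n%:R^-1)).
    by apply: continuousM => //; exact: cst_continuous.
  apply/differentiable_continuous/derivable1_diffP.
  have uV : 0 < u / V by rewrite divr_gt0.
  by have /@ex_derive := is_derive1_powR n%:R^-1 uV.
transitivity (\int[mu]_(u in `]0%R, +oo[) (G u)%:E)%E; last first.
  have dF (x : R) : 0 < x -> is_derive x 1 (fun r : R => V * r ^+ n) (V * (n%:R * x ^+ n.-1)).
    move=> _; have -> : (fun r : R => V * r ^+ n) = V \*: (id ^+ n : R -> R).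
      by apply/funext => r; rewrite /= exprfctE.
    have := is_deriveZ V (is_deriveX n (is_derive_id x (1 : R))).
    by move/is_derive_eq; apply; rewrite /GRing.scale/= mulr1.
  rewrite (@ge0_integral_subst_oy _ _ (fun r => V * (n%:R * r ^+ n.-1)) G 0 dF)//.
  - apply: eq_integral => r /[!inE]/= /[!in_itv]/= /[!andbT] r0.
    by rewrite GT.
  - by move=> x x0; rewrite mulr_gt0// mulr_gt0 ?ltr0n// exprn_gt0.
  - move=> x _; apply: cvgM; first exact: cvg_cst.
    by apply: cvgM; [exact: cvg_cst|exact: exprn_continuous].
  - apply: cvg_at_right_filter.
    rewrite -[X in _ --> X](_ : V * 0 ^+ n = 0); last by rewrite expr0n eqn0Ngt n0 mulr0.
    by apply: cvgM; [exact: cvg_cst|exact: exprn_continuous].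
  - apply: gt0_cvgMry => //; apply: (@ger_cvgy _ _ _ _ id); last exact: cvg_id.
    near=> x; have x1 : 1 <= x by near: x; exact: nbhs_pinfty_ge.
    by rewrite -[leLHS]expr1; apply: ler_weXn2l.
  - by move=> x x0; apply: g0; rewrite powR_gt0// divr_gt0.
have mG : measurable_fun (`]0, +oo[ : set R) (EFin \o G).
  by apply/measurable_EFinP; exact: measurable_funoy.
transitivity (\int[image_measure (lebesgueRn n) mT]_(u in `]0%R, +oo[) (G u)%:E)%E.
  rewrite [RHS]ge0_integral_pushforward//; last first.
    by move=> u /[!inE]/= /[!in_itv]/= /[!andbT] u0; rewrite lee_fin g0// powR_gt0// divr_gt0.
  rewrite (_ : T @^-1` _ = [set x | 0 < enorm x]); last first.
    apply/seteqP; split => x /=; rewrite in_itv/= andbT /T pmulr_rgt0//.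
      rewrite lt_neqAle => /andP[Vx _]; rewrite lt_neqAle enorm_ge0 andbT.
      by apply: contraNN Vx => /eqP <-; rewrite expr0n eqn0Ngt n0.
    exact: exprn_gt0.
  by apply: eq_integral => x /[!inE]/= x0; rewrite GT.
apply: eq_measure_integral => A mA A0; rewrite image_T// /mrestr setIidl//.
by move=> x /A0 /=; rewrite !in_itv/= !andbT => /ltW.
Unshelve. all: by end_near. Qed.

End image.

End polar.

(** * Polar coordinates: the area of the unit sphere *)

Section radial.
Context {R : realType}.
Local Notation mu := (@lebesgue_measure R).

Lemma is_derive_expr2 (x : R) : is_derive x 1 (fun r : R => r ^+ 2) (2 * x).
Proof.
have -> : (fun r : R => r ^+ 2) = (id ^+ 2 : R -> R) by apply/funext => r; rewrite exprfctE.
have := is_deriveX 2 (is_derive_id x (1 : R)).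
by move/is_derive_eq; apply; rewrite /GRing.scale/= mulr1 expr1.
Qed.

Lemma continuous_expr2 : continuous (fun r : R => r ^+ 2).
Proof. exact: exprn_continuous. Qed.

Lemma continuous_powR (a x : R) : 0 < x -> {for x, continuous (fun y => y `^ a)}.
Proof.
move=> x0; apply/differentiable_continuous/derivable1_diffP.
by have /@ex_derive := is_derive1_powR a x0.
Qed.

(** Substitute [t = r ^+ 2] in the defining integral. *)
Lemma Gamma_half n : (0 < n)%N ->
  (\int[mu]_(t in `]0%R, +oo[) (t `^ (n%:R / 2 - 1) * expR (- t))%:E =
   2%:E * \int[mu]_(r in `]0%R, +oo[) (gauss_fun r * r ^+ n.-1)%:E)%E.
Proof.
move=> n0.
pose G (t : R) := t `^ (n%:R / 2 - 1) * expR (- t).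
have cN : continuous (fun t : R => - t) by exact: opp_continuous.
rewrite (@ge0_integral_subst_oy _ _ (fun r => 2 * r) G 0 (fun x _ => is_derive_expr2 x))//.
- rewrite -ge0_integralZl//.
  + apply: eq_integral => r /[!inE]/= /[!in_itv]/= /[!andbT] r0.
    rewrite -EFinM /gauss_fun; congr EFin.
    rewrite /G -powR_mulrn ?(ltW r0)// -powRrM.
    have -> : r `^ (2 * (n%:R / 2 - 1)) = r ^+ n.-1 / r.
      have -> : 2 * (n%:R / 2 - 1) = n%:R - 2 :> R by lra.
      rewrite powRB; last by rewrite (gt_eqF r0) implybT.
      rewrite !powR_mulrn ?(ltW r0)//.
      by rewrite -(prednK n0) /= exprS expr2; field; rewrite gt_eqF.
    by field; rewrite gt_eqF.
  + apply/measurable_EFinP/measurable_funTS; apply: measurable_funM.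
      exact: measurable_gauss_fun.
    exact: exprn_measurable.
  + move=> r; rewrite /= in_itv/= andbT => r0.
    by rewrite lee_fin mulr_ge0 ?gauss_fun_ge0// exprn_ge0// ltW.
- by move=> x x0; rewrite mulr_gt0.
- by move=> x _; apply: cvgM; [exact: cvg_cst|exact: cvg_id].
- apply: cvg_at_right_filter; rewrite -[X in _ --> X](_ : 0 ^+ 2 = 0); last by rewrite expr0n.
  exact: continuous_expr2.
- exact: cvgr_expr2.
- move=> x; rewrite in_itv/= andbT => x0; apply: cvgM; first exact: continuous_powR.
  by apply: continuous_comp; [exact: cN|exact: continuous_expR].
- by move=> x x0; rewrite mulr_ge0 ?powR_ge0 ?expR_ge0.
Qed.

Definition sphere_area n : R := 2 * pi `^ (n%:R / 2) / Gamma (n%:R / 2).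

Lemma measurable_enorm_gt0 n : measurable [set x : Rn R n | 0 < enorm x].
Proof.
rewrite (_ : [set _ | _] = @enorm R n @^-1` `]0, +oo[).
  exact: measurable_enorm_preimage.
by apply/seteqP; split => x /=; rewrite in_itv/= andbT.
Qed.

Lemma measurable_fun_radial n (g : R -> R) : measurable_fun (`]0, +oo[ : set R) g ->
  measurable_fun [set x : Rn R n | 0 < enorm x] (g \o @enorm R n).
Proof.
move=> mg; apply: (measurable_comp _ _ mg); first exact: measurable_itv.
  by move=> _ [x /= x0 <-]; rewrite in_itv/= x0.
by apply: measurable_funTS; exact: measurable_enorm.
Qed.

(** The profiles may be singular at [0], so radial integrals are taken over the
    complement of the origin. *)
Lemma ge0_integral_enorm_gt0 n (f : Rn R n -> \bar R) : (0 < n)%N ->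
  measurable_fun [set: Rn R n] f -> (forall x, 0 <= f x)%E ->
  (\int[lebesgueRn n]_x f x =
   \int[lebesgueRn n]_(x in [set x : Rn R n | (0 < enorm x)%R]) f x)%E.
Proof.
move=> n0 mf f0.
have mN : measurable [set x : Rn R n | enorm x <= 0].
  rewrite (_ : [set _ | _] = ~` [set x : Rn R n | 0 < enorm x]).
    by apply: measurableC; exact: measurable_enorm_gt0.
  by apply/seteqP; split => x /=; rewrite leNgt => /negP.
rewrite (ge0_negligible_integral mN measurableT mf (fun x _ => f0 x) (measure_enorm_le0 n0)).
rewrite (_ : setT `\` _ = [set x : Rn R n | 0 < enorm x])//.
apply/seteqP; split => x /=; rewrite leNgt.
  by move=> [_ /negP]; rewrite negbK.
by move=> ->; split.
Qed.

(** Compute the integral of the Gaussian as a product of [n] integrals and by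
    [ge0_integral_radial_vol]. *)
Lemma sphere_areaE n : (0 < n)%N -> sphere_area n = ball_vol n * n%:R.
Proof.
move=> n0; have V0 := @ball_vol_gt0 R n.
have mg : measurable_fun [set: Rn R n] (fun x => (@gauss_fun R (enorm x))%:E).
  apply/measurable_EFinP.
  exact: (measurableT_comp (@measurable_gauss_fun R) (@measurable_enorm R n)).
have := @integral_gaussRn R n.
rewrite ge0_integral_enorm_gt0//; last by move=> x; rewrite lee_fin gauss_fun_ge0.
rewrite ge0_integral_radial_vol//; last 2 first.
- by move=> x _; exact: continuous_gauss_fun.
- by move=> r _; exact: gauss_fun_ge0.
pose I := (\int[mu]_(r in `]0%R, +oo[) (gauss_fun r * r ^+ n.-1)%:E)%E.
have I0 : (0 <= I)%E.
  apply: integral_ge0 => r; rewrite /= in_itv/= andbT => r0.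
  by rewrite lee_fin mulr_ge0 ?gauss_fun_ge0// exprn_ge0// ltW.
have -> : (\int[mu]_(r in `]0%R, +oo[) (gauss_fun r * (ball_vol n * (n%:R * r ^+ n.-1)))%:E =
    (ball_vol n * n%:R)%:E * I)%E.
  rewrite -ge0_integralZl//; last 3 first.
  - apply/measurable_EFinP/measurable_funTS; apply: measurable_funM.
      exact: measurable_gauss_fun.
    exact: exprn_measurable.
  - move=> r; rewrite /= in_itv/= andbT => r0.
    by rewrite lee_fin mulr_ge0 ?gauss_fun_ge0// exprn_ge0// ltW.
  - by rewrite lee_fin mulr_ge0// ltW.
  by apply: eq_integral => r _; rewrite -EFinM; congr EFin; ring.
have Vn : 0 < ball_vol n * n%:R :> R by rewrite mulr_gt0// ltr0n.
have p0 : 0 < Num.sqrt pi ^+ n :> R by rewrite exprn_gt0// sqrtr_gt0 pi_gt0.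
have piE : Num.sqrt pi ^+ n = pi `^ (n%:R / 2) :> R.
  rewrite -powR_mulrn ?sqrtr_ge0// -powR12_sqrt ?pi_ge0//.
  by rewrite -powRrM (mulrC 2^-1).
move=> VI; have Ify : I \is a fin_num.
  rewrite ge0_fin_numE// ltey; apply/eqP => Iy.
  by move: VI; rewrite Iy gt0_muley// lte_fin.
move: VI; rewrite -(fineK Ify) -EFinM => -[VI].
rewrite /sphere_area -piE /Gamma /Rintegral Gamma_half// -/I -(fineK Ify) -EFinM/=.
have fI0 : fine I != 0.
  by apply: contra_eq_neq VI => ->; rewrite mulr0 lt_eqF.
by rewrite -VI; field; rewrite fI0.
Qed.

(** [ge0_integral_radial_vol] with the constant that [sphere_areaE] identifies. *)
Lemma ge0_integral_radial n (g : R -> R) : (0 < n)%N ->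
  {in `]0, +oo[, continuous g} -> (forall r, 0 < r -> 0 <= g r) ->
  (\int[lebesgueRn n]_(x in [set x : Rn R n | (0 < enorm x)%R]) (g (enorm x))%:E =
   (sphere_area n)%:E * \int[mu]_(r in `]0%R, +oo[) (g r * r ^+ n.-1)%:E)%E.
Proof.
move=> n0 cg g0; rewrite ge0_integral_radial_vol// -ge0_integralZl//; last 3 first.
- apply/measurable_EFinP; apply: measurable_funM; last exact: exprn_measurable.
  exact: measurable_funoy.
- move=> r; rewrite /= in_itv/= andbT => r0.
  by rewrite lee_fin mulr_ge0 ?g0// exprn_ge0// ltW.
- by rewrite lee_fin sphere_areaE// mulr_ge0// ball_vol_ge0.
apply: eq_integral => r _; rewrite -EFinM sphere_areaE//; congr EFin; ring.
Qed.

Lemma sphere_area2 : sphere_area 2 = 2 * pi.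
Proof.
rewrite /sphere_area divff// powRr1 ?pi_ge0//.
suff -> : Gamma 1 = 1 :> R by rewrite divr1.
rewrite /Gamma /Rintegral.
have cE : {within `[0, +oo[, continuous (fun x : R => expR (- x))}.
  apply: continuous_subspaceT => x; apply: continuous_comp; last exact: continuous_expR.
  exact: opp_continuous.
under eq_integral.
  move=> t; rewrite inE/= in_itv/= andbT => t0.
  rewrite subrr powRr0 mul1r; over.
rewrite integral_itv_obnd_cbnd; last first.
  by apply/measurable_EFinP/measurable_funTS; apply: measurableT_comp.
rewrite (@ge0_continuous_FTC2y _ _ (fun x => - expR (- x)) _ 0)//.
- by rewrite oppr0 expR0 sub0e -EFinN opprK.
- rewrite -oppr0; apply: cvgN; exact: cvgr_expR.
- apply: cvg_at_right_filter; apply: cvgN.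
  by apply: continuous_comp; [exact: opp_continuous|exact: continuous_expR].
- move=> x _; rewrite derive1E.
  have d : is_derive x 1 (fun x : R => - expR (- x)) (expR (- x)).
    have h := is_deriveN (is_derive1_comp (is_derive_expR (- x)) (is_deriveNid x 1)).
    by move/is_derive_eq : h; apply; rewrite mulrN1 opprK.
  by rewrite derive_val.
Qed.

End radial.

(** * Averages over the hyperbolic cosine *)

Section hyperbolic.
Context {R : realType}.
Local Notation mu := (@lebesgue_measure R).

Definition sinh (x : R) : R := (expR x - expR (- x)) / 2.

Lemma continuous_expRN : continuous (fun x : R => expR (- x)).
Proof.
move=> x; apply: continuous_comp; last exact: continuous_expR.
exact: opp_continuous.
Qed.

Lemma continuous_cosh : continuous (@cosh R).
Proof.
move=> x; apply: cvgM; last exact: cvg_cst.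
by apply: cvgD; [exact: continuous_expR|exact: continuous_expRN].
Qed.

Lemma measurable_cosh : measurable_fun setT (@cosh R).
Proof. by apply: continuous_measurable_fun; exact: continuous_cosh. Qed.

Lemma is_derive_expRN (x : R) : is_derive x 1 (fun x : R => expR (- x)) (- expR (- x)).
Proof.
have := is_derive1_comp (is_derive_expR (- x)) (is_deriveNid x 1).
by move/is_derive_eq; apply; rewrite mulrN1.
Qed.

Lemma is_derive_sinh (x : R) : is_derive x 1 sinh (cosh x).
Proof.
have -> : sinh = (2^-1 : R) \*: (expR - (fun x => expR (- x)))%R.
  by apply/funext => y; rewrite /sinh/= /GRing.scale/= mulrC.
have := is_deriveZ (2^-1 : R) (is_deriveB (is_derive_expR x) (is_derive_expRN x)).
by move/is_derive_eq; apply; rewrite /GRing.scale/= /cosh opprK mulrC.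
Qed.

Lemma cosh2_sinh2 (x : R) : cosh x ^+ 2 = 1 + sinh x ^+ 2.
Proof.
have := expRxMexpNx_1 x; rewrite /cosh /sinh; move: (expR x) (expR (- x)) => a b ab.
by transitivity (a * b + ((a - b) / 2) ^+ 2); [field|rewrite ab].
Qed.

Lemma cosh_ge1 (x : R) : 1 <= cosh x.
Proof.
have := expRxMexpNx_1 x; have := expR_gt0 x; have := expR_gt0 (- x).
rewrite /cosh; move: (expR x) (expR (- x)) => a b a0 b0 ab.
rewrite ler_pdivlMr// mul1r -subr_ge0.
have -> : a + b - 2 = b * (a - 1) ^+ 2.
  by transitivity (a * (a * b) - 2 * (a * b) + b); [rewrite ab; ring|ring].
by rewrite mulr_ge0 ?sqr_ge0// ltW.
Qed.

Lemma cosh_gt0 (x : R) : 0 < cosh x.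
Proof. by rewrite (lt_le_trans ltr01)// cosh_ge1. Qed.

(** Since [cosh x - 1 = (expR (x / 2) - expR (- (x / 2))) ^+ 2 / 2], it suffices
    that [expR (x / 2) >= 1 + x / 2].  The constant [1 / 8] is not optimal. *)
Lemma cosh_ge_sqr (x : R) : 0 <= x -> 1 + x ^+ 2 / 8 <= cosh x.
Proof.
move=> x0; have := expRxMexpNx_1 (x / 2).
have : expR (- (x / 2)) <= 1 by rewrite expR_le1; lra.
have := expR_ge1Dx (x / 2).
have -> : cosh x = (expR (x / 2) ^+ 2 + expR (- (x / 2)) ^+ 2) / 2.
  by rewrite -!expRM_natl /cosh; congr ((expR _ + expR _) / _); lra.
have := expR_gt0 (- (x / 2)).
move: (expR (x / 2)) (expR (- (x / 2))) => a b b0 ax b1 ab.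
have : (a - b) ^+ 2 >= (x / 2) ^+ 2 by rewrite ler_pXn2r// ?nnegrE; lra.
by move=> h; nra.
Qed.

Lemma sinh0 : sinh 0 = 0.
Proof. by rewrite /sinh oppr0 subrr mul0r. Qed.

Lemma sinh_cvg0 : sinh x @[x --> 0^'+] --> 0.
Proof.
apply: cvg_at_right_filter; rewrite -{2}sinh0.
apply/differentiable_continuous/derivable1_diffP.
by have /@ex_derive := is_derive_sinh 0.
Qed.

Lemma sinh_cvgy : sinh x @[x --> +oo] --> +oo.
Proof.
apply: (@ger_cvgy _ _ _ _ (fun x : R => 2^-1 * x)); last first.
  by apply: gt0_cvgMry => //; exact: cvg_id.
near=> x; have x0 : 0 <= x by near: x; exact: nbhs_pinfty_ge.
have : expR (- x) <= 1 by rewrite expR_le1; lra.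
by have := expR_ge1Dx x; rewrite /sinh; lra.
Unshelve. all: by end_near. Qed.

Lemma integral_gauss_scale (c : R) : 0 < c ->
  (\int[mu]_(s in `[0%R, +oo[) (gauss_fun (c * s))%:E = (Num.sqrt pi / 2 / c)%:E)%E.
Proof.
move=> c0.
have d (x : R) : 0 < x -> is_derive x 1 (fun s : R => c * s) c.
  move=> _; have := is_deriveZ c (is_derive_id x (1 : R)).
  by move/is_derive_eq; apply; rewrite /GRing.scale/= mulr1.
have cc : continuous (fun s : R => c * s).
  by move=> x; apply: cvgM; [exact: cvg_cst|exact: cvg_id].
have mg : measurable_fun setT (fun s => gauss_fun (c * s)).
  apply: continuous_measurable_fun => x; apply: continuous_comp; first exact: cc.
  exact: continuous_gauss_fun.
rewrite -integral_itv_obnd_cbnd; last exact/measurable_EFinP/measurable_funTS.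
have := @integral0y_gauss R.
rewrite -integral_itv_obnd_cbnd; last first.
  by apply/measurable_EFinP/measurable_funTS; exact: measurable_gauss_fun.
rewrite (ge0_integral_subst_oy (b := 0) d)//.
- under eq_integral do rewrite mulrC EFinM.
  rewrite ge0_integralZl//; last first.
  + by rewrite lee_fin ltW.
  + by move=> x _; rewrite lee_fin gauss_fun_ge0.
  + by apply/measurable_EFinP/measurable_funTS.
  move=> h; rewrite [in RHS]mulrC EFinM -h muleA -EFinM mulVf ?gt_eqF// mul1e//.
- by move=> x _; exact: cvg_cst.
- by apply: cvg_at_right_filter; rewrite -[X in _ --> X](mulr0 c); exact: cc.
- by apply: gt0_cvgMry => //; exact: cvg_id.
- by move=> x _; exact: continuous_gauss_fun.
- by move=> x _; exact: gauss_fun_ge0.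
Qed.

Lemma continuous_expN_cosh (r : R) : continuous (fun s : R => expR (- (r * cosh s))).
Proof.
move=> x; apply: continuous_comp; last exact: continuous_expR.
by apply: cvgN; apply: cvgM; [exact: cvg_cst|exact: continuous_cosh].
Qed.

Lemma measurable_expN_cosh (r : R) D : measurable_fun D (fun s : R => expR (- (r * cosh s))).
Proof.
by apply: measurable_funTS; apply: continuous_measurable_fun; exact: continuous_expN_cosh.
Qed.

(** Bound [cosh s - 1] below by [s ^+ 2 / 8] and integrate the Gaussian.  The factor
    [1 / Num.sqrt r] is what makes the exponent [1 / 2] critical. *)
Lemma integral_expN_cosh_le (r : R) : 0 < r ->
  (\int[mu]_(s in `[0%R, +oo[) (expR (- (r * cosh s)))%:E <=
   (expR (- r) * (Num.sqrt (2 * pi) / Num.sqrt r))%:E)%E.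
Proof.
move=> r0; pose c := Num.sqrt r / Num.sqrt 8.
have r0' := sqrtr_gt0 r; rewrite r0 in r0'.
have c0 : 0 < c by rewrite divr_gt0// sqrtr_gt0.
have -> : Num.sqrt (2 * pi) / Num.sqrt r = Num.sqrt pi / 2 / c.
  rewrite /c sqrtrM// (_ : 8 = 2 ^+ 2 * 2); last by rewrite expr2; lra.
  rewrite sqrtrM ?sqr_ge0// sqrtr_sqr ger0_norm//; field.
  by rewrite !gt_eqF// sqrtr_gt0.
have mg : measurable_fun (`[0, +oo[ : set R) (fun s => (@gauss_fun R (c * s))%:E).
  apply/measurable_EFinP/measurable_funTS; apply: (measurableT_comp (@measurable_gauss_fun R)).
  exact: measurable_funM.
rewrite EFinM -(integral_gauss_scale c0) -ge0_integralZl//.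
- apply: ge0_le_integral => //.
  + by apply/measurable_EFinP; exact: measurable_expN_cosh.
  + by apply: measurable_funeM; exact: mg.
  + move=> s; rewrite /= in_itv/= andbT => s0; rewrite -EFinM lee_fin -expRD ler_expR.
    rewrite exprMn exprMn exprVn !sqr_sqrtr ?(ltW r0)//.
    have := cosh_ge_sqr s0; move: (cosh s) => C h.
    have -> : - r - r * 8^-1 * s ^+ 2 = - (r * (1 + s ^+ 2 / 8)) by field.
    by rewrite lerN2 ler_pM2l.
- by move=> x _; rewrite lee_fin gauss_fun_ge0.
Qed.

Lemma integrable_expN_cosh (r : R) : 0 < r ->
  mu.-integrable `[0, +oo[ (EFin \o (fun s => expR (- (r * cosh s)))).
Proof.
move=> r0; apply/integrableP; split.
  by apply/measurable_EFinP; exact: measurable_expN_cosh.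
under eq_integral => s _ do rewrite /= ger0_norm ?expR_ge0//.
exact: (le_lt_trans (integral_expN_cosh_le r0) (ltry _)).
Qed.

Lemma integrable_cexpN_cosh (C r : R) : 0 < r ->
  mu.-integrable `[0, +oo[ (EFin \o (fun s => C * expR (- (r * cosh s)))).
Proof.
move=> r0; have := integrable_expN_cosh r0.
by move=> /(@integrableZl _ _ _ _ _ _ C); apply.
Qed.

Lemma M0_le (r : R) : 0 < r -> M0 r <= expR (- r) * (Num.sqrt (2 * pi) / Num.sqrt r).
Proof.
move=> r0; rewrite /M0 /Rintegral -lee_fin fineK; last first.
  exact: (integrable_fin_num _ (integrable_expN_cosh r0)).
exact: integral_expN_cosh_le.
Qed.

Lemma M0_ge0 (r : R) : 0 <= M0 r.
Proof. by apply: Rintegral_ge0 => s _; exact: expR_ge0. Qed.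

(** This maps [expR (- w)] to [M0], and [half_derive J] to [abel J] up to a factor. *)
Definition coshint (f : R -> R) (r : R) : R := \int[mu]_(s in `[0, +oo[) f (r * cosh s).

Section coshint.
Variable f : R -> R.
Hypothesis cf : {in `]0, +oo[, continuous f}.

Let mf (r : R) (D : set R) : 0 < r -> measurable D ->
  measurable_fun D (fun s => f (r * cosh s)).
Proof.
move=> r0 mD; apply: (measurable_comp _ _ (measurable_funoy cf)); first exact: measurable_itv.
  by move=> _ [s _ <-]; rewrite /= in_itv/= mulr_gt0// cosh_gt0.
by apply: measurable_funTS; apply: measurable_funM => //; exact: measurable_cosh.
Qed.

Lemma integrable_coshint (C r : R) : 0 < r ->
  (forall w, r <= w -> `|f w| <= C * expR (- w)) ->
  mu.-integrable `[0, +oo[ (EFin \o (fun s => f (r * cosh s))).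
Proof.
move=> r0 fC; apply: le_integrable (integrable_cexpN_cosh C r0) => //.
- by apply/measurable_EFinP; exact: mf.
- move=> s _; rewrite lee_fin (le_trans (fC _ _))//; last exact: ler_norm.
  by rewrite ler_peMr ?cosh_ge1// ltW.
Qed.

Lemma coshint_le (C r : R) : 0 < r ->
  (forall w, r <= w -> `|f w| <= C * expR (- w)) -> `|coshint f r| <= C * M0 r.
Proof.
move=> r0 fC; have fi := integrable_coshint r0 fC; rewrite /coshint.
apply: (le_trans (le_normr_Rintegral _ fi)) => //.
rewrite /M0 -RintegralZl//; last exact: integrable_expN_cosh.
apply: le_Rintegral => //.
- by have /integrable_norm := fi.
- exact: integrable_cexpN_cosh.
- by move=> s _; apply: fC; rewrite ler_peMr ?cosh_ge1// ltW.
Qed.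

(** Near [r] the integrand is dominated by [C * expR (- (r / 2 * cosh s))]. *)
Lemma continuous_coshint (C : R) : (forall w, 0 < w -> `|f w| <= C * expR (- w)) ->
  {in `]0, +oo[, continuous (coshint f)}.
Proof.
move=> fC r; rewrite in_itv/= andbT => r0.
have ru : r \in `]r / 2, r + 1[%classic.
  by rewrite inE/= in_itv/=; apply/andP; split; lra.
have r2 : 0 < r / 2 by rewrite divr_gt0.
apply: (@continuity_under_integral _ _ _ mu (fun x s => f (x * cosh s)) `[0, +oo[ _ (r / 2) (r + 1)
  _ _ (fun s => C * expR (- (r / 2 * cosh s)))) => //.
- move=> x; rewrite /= in_itv/= => /andP[rx _]; have x0 : 0 < x by lra.
  by apply: (@integrable_coshint C) => // w xw; apply: fC; exact: lt_le_trans xw.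
- apply: aeW => s _ x; rewrite inE/= in_itv/= => /andP[rx _].
  apply: (@continuous_comp _ _ _ (fun x : R => x * cosh s) f); last first.
    by apply: cf; rewrite in_itv/= andbT mulr_gt0 ?cosh_gt0//; lra.
  by apply: cvgM; [exact: cvg_id|exact: cvg_cst].
- exact: integrable_cexpN_cosh.
- move=> x; rewrite /= in_itv/= => /andP[rx _]; apply: aeW => s _.
  have x0 : 0 < x by lra.
  apply: (le_trans (fC _ _)); first by rewrite mulr_gt0 ?cosh_gt0.
  have C0 : 0 <= C by have := le_trans (normr_ge0 _) (fC _ ltr01); rewrite pmulr_lge0 ?expR_gt0.
  by rewrite ler_wpM2l// ler_expR lerN2 ler_pM2r ?cosh_gt0// ltW.
Qed.

End coshint.

Lemma continuous_M0 : {in `]0, +oo[, continuous (@M0 R)}.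
Proof.
apply: (@continuous_coshint (fun w => expR (- w)) _ 1).
  by move=> x _; exact: continuous_expRN.
by move=> w _; rewrite mul1r ger0_norm ?expR_ge0.
Qed.

End hyperbolic.

(** * The Abel transform of a nonnegative function *)

Section abel.
Context {R : realType}.
Local Notation mu := (@lebesgue_measure R).

(** Extend by zero outside of the rectangle. *)
Lemma tonelli_itv (D1 D2 : interval R) (f : R * R -> \bar R) :
  measurable_fun [set: measurableTypeR R * measurableTypeR R] f ->
  (forall z, 0 <= f z)%E ->
  (\int[mu]_(x in [set` D1]) \int[mu]_(y in [set` D2]) f (x, y) =
   \int[mu]_(y in [set` D2]) \int[mu]_(x in [set` D1]) f (x, y))%E.
Proof.
move=> mf f0.
have mD (D : interval R) : measurable ([set` D] : set (measurableTypeR R)).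
  exact: measurable_itv.
pose D : set (measurableTypeR R * measurableTypeR R) := [set` D1] `*` [set` D2].
have mD12 : measurable D by exact: measurableX.
have mfD : measurable_fun setT (f \_ D).
  by apply/(measurable_restrictT _ mD12); exact: measurable_funTS.
have fD0 z : (0 <= (f \_ D) z)%E by exact: erestrict_ge0.
have := @fubini_tonelli _ _ _ _ R (@lebesgue_measure R) (@lebesgue_measure R) _ mfD fD0.
have E1 x : (\int[mu]_y (f \_ D) (x, y) =
    ((fun x => \int[mu]_(y in [set` D2]) f (x, y)) \_ [set` D1]) x)%E.
  rewrite patchE; case: ifPn => x1.
    rewrite [RHS]integral_mkcond; apply: eq_integral => y _; rewrite !patchE.
    by rewrite in_setX x1.
  by rewrite integral0_eq// => y _; rewrite patchE in_setX (negbTE x1).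
have E2 y : (\int[mu]_x (f \_ D) (x, y) =
    ((fun y => \int[mu]_(x in [set` D1]) f (x, y)) \_ [set` D2]) y)%E.
  rewrite patchE; case: ifPn => y1.
    rewrite [RHS]integral_mkcond; apply: eq_integral => x _; rewrite !patchE.
    by rewrite in_setX y1 andbT.
  by rewrite integral0_eq// => x _; rewrite patchE in_setX (negbTE y1) andbF.
under eq_integral do rewrite E1.
under [in X in _ = X -> _]eq_integral do rewrite E2.
by rewrite -!integral_mkcond.
Qed.

Lemma ge0_integralT_even (f : R -> \bar R) : measurable_fun [set: R] f ->
  (forall x, 0 <= f x)%E -> (forall x, f (- x) = f x) ->
  (\int[mu]_x f x = 2%:E * \int[mu]_(x in `]0%R, +oo[) f x)%E.
Proof.
move=> mf f0 fN.
have m1 (D : set R) : measurable_fun D f by exact: measurable_funTS.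
have yE : (\int[mu]_(x in `]-oo, 0%R[) f x = \int[mu]_(x in `]0%R, +oo[) f x)%E.
  rewrite integral_itv_bndo_bndc// integral_itv_obnd_cbnd//.
  by rewrite ge0_integration_by_substitution0//; apply: eq_integral.
rewrite -(setUv `]-oo, 0%R[%classic) ge0_integral_setU//=; last 3 first.
- exact: measurableC.
- exact: m1.
- exact/disj_setPCl.
by rewrite setCitvl -integral_itv_obnd_cbnd// yE mule_natl mule2n.
Qed.

(** The plane is made of four quadrants. *)
Lemma integral_quadrant (H : R -> R) : measurable_fun setT H ->
  (forall u, 0 <= H u) ->
  (4%:E * \int[mu]_(p in `]0%R, +oo[) \int[mu]_(q in `]0%R, +oo[) (H (p ^+ 2 + q ^+ 2))%:E
   = \int[lebesgueRn 2]_x (H (enorm x ^+ 2))%:E)%E.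
Proof.
move=> mH H0.
have mf : measurable_fun [set: Rn R 2] (fun x => (H (enorm x ^+ 2))%:E).
  apply/measurable_EFinP; apply: (measurableT_comp mH).
  by apply: measurable_funX; exact: measurable_enorm.
have mi p : measurable_fun setT (fun q : R => (H (p ^+ 2 + q ^+ 2))%:E).
  apply/measurable_EFinP; apply: (measurableT_comp mH).
  by apply: measurable_funD => //; exact: exprn_measurable.
have ev p : (\int[mu]_q (H (p ^+ 2 + q ^+ 2))%:E =
    2%:E * \int[mu]_(q in `]0%R, +oo[) (H (p ^+ 2 + q ^+ 2))%:E)%E.
  rewrite ge0_integralT_even//; first by move=> q; rewrite lee_fin.
  by move=> q; rewrite sqrrN.
have mo : measurable_fun setT (fun p : R => \int[mu]_q (H (p ^+ 2 + q ^+ 2))%:E)%E.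
  apply: (@measurable_fun_fubini_tonelli_F _ _ (measurableTypeR R)
     (measurableTypeR R) R (@lebesgue_measure R)
     (fun z => (H (z.1 ^+ 2 + z.2 ^+ 2))%:E)) => //=; last by move=> z; rewrite lee_fin.
  apply/measurable_EFinP; apply: (measurableT_comp mH).
  by apply: measurable_funD; apply: measurable_funX.
have f0 (x : Rn R 2) : (0 <= (H (enorm x ^+ 2))%:E)%E by rewrite lee_fin.
have mf1 := measurable_fun_inner mf f0.
have f1 (z : Rn R 1) : (0 <= \int[mu]_y (H (enorm (tuple_of_prod (z, y)) ^+ 2))%:E)%E.
  by apply: integral_ge0 => y _; rewrite lee_fin.
rewrite ge0_integral_lebesgueRnS// ge0_integral_lebesgueRnS//.
rewrite integral_dirac//; last exact: (measurable_fun_inner mf1 f1).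
rewrite diracT mul1e.
under [RHS]eq_integral => p _.
  under eq_integral do rewrite !sqr_enormS addrC.
  rewrite /enorm big_ord0 sqrtr0 expr0n/= addr0.
  over.
rewrite ge0_integralT_even//; last 2 first.
- by move=> p; apply: integral_ge0 => q _; rewrite lee_fin.
- by move=> p; rewrite sqrrN.
have -> : (4%:E = 2%:E * 2%:E :> \bar R)%E by rewrite -EFinM; congr EFin; lra.
rewrite -muleA -ge0_integralZl//.
- by under [in RHS]eq_integral do rewrite ev.
- have -> : (fun p : R => \int[mu]_(q in `]0%R, +oo[) (H (p ^+ 2 + q ^+ 2))%:E)%E =
     (fun p : R => 2^-1%:E * \int[mu]_q (H (p ^+ 2 + q ^+ 2))%:E)%E.
    by apply/funext => p; rewrite ev muleA -EFinM mulVf// mul1e.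
  by apply: measurable_funTS; apply: measurable_funeM.
- by move=> p _; apply: integral_ge0 => q _; rewrite lee_fin.
Qed.

Section inversion.
Variables (g : R -> R) (r : R).
Hypothesis r0 : 0 < r.
Hypothesis cg : {in `]0, +oo[, continuous g}.
Hypothesis g0 : forall w, 0 < w -> 0 <= g w.

(** In the coordinates [p] and [q] of [ge0_abel_inversion] below, the double
    integral is that of [W (1 + p ^+ 2 + q ^+ 2)].  The extension by zero makes [W]
    measurable on the whole line. *)
Let W : R -> R := (fun u => r * g (r * Num.sqrt u) / Num.sqrt u) \_ `]0, +oo[.

Let WE u : 0 < u -> W u = r * g (r * Num.sqrt u) / Num.sqrt u.
Proof. by move=> u0; rewrite /W patchE mem_set//= in_itv/= u0. Qed.

Let W0 u : 0 <= W u.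
Proof.
rewrite /W patchE; case: ifPn => // /[!inE]/= /[!in_itv]/= /[!andbT] u0.
by rewrite divr_ge0 ?sqrtr_ge0// mulr_ge0 ?(ltW r0)// g0// mulr_gt0// sqrtr_gt0.
Qed.

Let cW' : {in `]0, +oo[, continuous (fun u => r * g (r * Num.sqrt u) / Num.sqrt u)}.
Proof.
move=> u; rewrite in_itv/= andbT => u0.
have su : 0 < Num.sqrt u by rewrite sqrtr_gt0.
apply: cvgM; last first.
  by apply: cvgV; [rewrite gt_eqF|exact: sqrt_continuous].
apply: cvgM; first exact: cvg_cst.
apply: (@continuous_comp _ _ _ (fun u : R => r * Num.sqrt u) g).
  by apply: cvgM; [exact: cvg_cst|exact: sqrt_continuous].
by apply: cg; rewrite in_itv/= andbT mulr_gt0.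
Qed.

Let cW : {in `]0, +oo[, continuous W}.
Proof.
move=> u u0; have := u0; rewrite in_itv/= andbT => u0'.
rewrite /continuous_at WE//.
apply: (cvg_trans _ (cW' u0)); apply: near_eq_cvg.
by near=> v; rewrite WE//; near: v; exact: lt_nbhsr.
Unshelve. all: by end_near. Qed.

Let mW : measurable_fun setT W.
Proof.
have mD : measurable (`]0, +oo[%classic : set R) by exact: measurable_itv.
by apply/(measurable_restrictT _ mD); exact: measurable_funoy.
Qed.

(** Substitute [q = cosh t * sinh s]. *)
Let inner_s t :
  (\int[mu]_(s in `]0%R, +oo[) (r * cosh t * g (r * cosh t * cosh s))%:E =
   \int[mu]_(q in `]0%R, +oo[) (cosh t * W (cosh t ^+ 2 + q ^+ 2))%:E)%E.
Proof.
have c0 := cosh_gt0 t; set c := cosh t in c0 *.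
have d (x : R) : 0 < x -> is_derive x 1 (fun s => c * sinh s) (c * cosh x).
  by move=> _; exact: is_deriveZ (is_derive_sinh x).
rewrite [RHS](ge0_integral_subst_oy (b := 0) d)//.
- apply: eq_integral => s _; congr EFin.
  have -> : c ^+ 2 + (c * sinh s) ^+ 2 = (c * cosh s) ^+ 2.
    by rewrite (exprMn 2 c (cosh s)) (cosh2_sinh2 s); ring.
  have cs0 : 0 < c * cosh s by rewrite mulr_gt0 ?cosh_gt0.
  rewrite WE ?exprn_gt0// sqrtr_sqr gtr0_norm// -(mulrA r c (cosh s)).
  by field; rewrite !gt_eqF// cosh_gt0.
- by move=> x _; rewrite mulr_gt0 ?cosh_gt0.
- by move=> x _; apply: cvgM; [exact: cvg_cst|exact: continuous_cosh].
- by rewrite -[X in _ --> X](mulr0 c); apply: cvgM; [exact: cvg_cst|exact: sinh_cvg0].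
- by apply: gt0_cvgMry => //; exact: sinh_cvgy.
- move=> q _; apply: cvgM; first exact: cvg_cst.
  apply: (@continuous_comp _ _ _ (fun q : R => c ^+ 2 + q ^+ 2) W).
    by apply: cvgD; [exact: cvg_cst|exact: exprn_continuous].
  by apply: cW; rewrite in_itv/= andbT ltr_wpDr ?sqr_ge0// exprn_gt0.
- by move=> q _; rewrite mulr_ge0// ltW.
Qed.

(** Substitute [p = sinh t]. *)
Let inner_t q :
  (\int[mu]_(t in `]0%R, +oo[) (cosh t * W (cosh t ^+ 2 + q ^+ 2))%:E =
   \int[mu]_(p in `]0%R, +oo[) (W (1 + (q ^+ 2 + p ^+ 2)))%:E)%E.
Proof.
rewrite [RHS](ge0_integral_subst_oy (b := 0) (fun x _ => is_derive_sinh x))//.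
- apply: eq_integral => t _; congr EFin; rewrite mulrC; congr (W _ * _).
  by rewrite cosh2_sinh2; ring.
- by move=> x _; exact: cosh_gt0.
- by move=> x _; exact: continuous_cosh.
- exact: sinh_cvg0.
- exact: sinh_cvgy.
- move=> p _; apply: (@continuous_comp _ _ _ (fun p : R => 1 + (q ^+ 2 + p ^+ 2)) W).
    apply: cvgD; first exact: cvg_cst.
    by apply: cvgD; [exact: cvg_cst|exact: exprn_continuous].
  by apply: cW; rewrite in_itv/= andbT ltr_wpDr// addr_ge0 ?sqr_ge0.
Qed.

(** Substitute [w = r * Num.sqrt (1 + p ^+ 2)]. *)
Let outer_w :
  (\int[mu]_(w in `]r, +oo[) (g w)%:E =
   \int[mu]_(p in `]0%R, +oo[) (W (1 + p ^+ 2) * p ^+ 1)%:E)%E.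
Proof.
have p1 (p : R) : 0 < 1 + p ^+ 2 by rewrite ltr_wpDr// sqr_ge0.
have sp1 (p : R) : 0 < Num.sqrt (1 + p ^+ 2) by rewrite sqrtr_gt0.
have c1 : continuous (fun p : R => 1 + p ^+ 2).
  by move=> p; apply: cvgD; [exact: cvg_cst|exact: exprn_continuous].
have cs : continuous (fun p : R => Num.sqrt (1 + p ^+ 2)).
  move=> p; apply: (@continuous_comp _ _ _ (fun p : R => 1 + p ^+ 2) Num.sqrt).
    exact: c1.
  exact: sqrt_continuous.
have d (p : R) : 0 < p -> is_derive p 1 (fun p => r * Num.sqrt (1 + p ^+ 2))
    (r * (p / Num.sqrt (1 + p ^+ 2))).
  move=> _.
  have d1 : is_derive p 1 (fun p : R => 1 + p ^+ 2) (2 * p).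
    have := is_deriveD (is_derive_cst (1 : R) p (1 : R)) (is_derive_expr2 p).
    by move/is_derive_eq; apply; rewrite add0r.
  have := is_deriveZ r (@is_derive1_comp R Num.sqrt (fun p => 1 + p ^+ 2) p _ _
    (is_derive1_sqrt (p1 p)) d1).
  move/is_derive_eq; apply; rewrite /GRing.scale/=; congr (_ * _).
  by field; rewrite gt_eqF.
rewrite (ge0_integral_subst_oy (b := r) d)//.
- apply: eq_integral => p _; congr EFin; rewrite WE// expr1.
  by field; rewrite gt_eqF.
- by move=> p p0; rewrite mulr_gt0// divr_gt0.
- move=> p _; apply: cvgM; first exact: cvg_cst.
  by apply: cvgM; [exact: cvg_id|apply: cvgV; [rewrite gt_eqF|exact: cs]].
- apply: cvg_at_right_filter.
  rewrite -[X in _ --> X](_ : r * Num.sqrt (1 + 0 ^+ 2) = r); last first.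
    by rewrite expr0n addr0 sqrtr1 mulr1.
  by apply: cvgM; [exact: cvg_cst|exact: cs].
- apply: gt0_cvgMry => //; apply: (@ger_cvgy _ _ _ _ id); last exact: cvg_id.
  near=> p; have p0 : 0 <= p by near: p; exact: nbhs_pinfty_ge.
  by rewrite -[leLHS]ger0_norm// -sqrtr_sqr ler_wsqrtr// lerDr.
- by move=> w; rewrite in_itv/= andbT => rw; apply: cg; rewrite in_itv/= andbT (lt_trans r0).
- by move=> w rw; apply: g0; exact: lt_trans rw.
Unshelve. all: by end_near. Qed.

(** In the quarter plane with coordinates [p = sinh t] and
    [q = cosh t * sinh s] one has [1 + p ^+ 2 + q ^+ 2 = (cosh t * cosh s) ^+ 2]
    and [dp dq = cosh t ^+ 2 * cosh s dt ds], so that the integrand becomes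
    radial.  Tonelli's theorem allows one to substitute [q] first, at fixed [t],
    and then [p], at fixed [q]. *)
Lemma ge0_abel_inversion :
  (\int[mu]_(t in `]0%R, +oo[) \int[mu]_(s in `]0%R, +oo[)
      (r * cosh t * g (r * cosh t * cosh s))%:E =
   (pi / 2)%:E * \int[mu]_(w in `]r, +oo[) (g w)%:E)%E.
Proof.
under eq_integral do rewrite inner_s.
rewrite (@tonelli_itv _ _ (fun z => (cosh z.1 * W (cosh z.1 ^+ 2 + z.2 ^+ 2))%:E)); last 2 first.
- apply/measurable_EFinP; apply: measurable_funM.
    exact: (measurableT_comp measurable_cosh).
  apply: (measurableT_comp mW); apply: measurable_funD; last by apply: measurable_funX.
  by apply: measurable_funX; exact: (measurableT_comp measurable_cosh).
- by move=> z; rewrite lee_fin mulr_ge0// ltW// cosh_gt0.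
under eq_integral do rewrite /= inner_t.
pose H u := W (1 + u).
have mH : measurable_fun setT H by apply: (measurableT_comp mW); exact: measurable_funD.
have := @integral_quadrant H mH (fun u => W0 _).
rewrite ge0_integral_enorm_gt0//; last 2 first.
- apply/measurable_EFinP; apply: (measurableT_comp mH); apply: measurable_funX.
  exact: measurable_enorm.
- by move=> x; rewrite lee_fin W0.
rewrite (@ge0_integral_radial _ 2 (fun p => W (1 + p ^+ 2)))//; last first.
  move=> p _; apply: (@continuous_comp _ _ _ (fun p : R => 1 + p ^+ 2) W).
    by apply: cvgD; [exact: cvg_cst|exact: exprn_continuous].
  by apply: cW; rewrite in_itv/= andbT ltr_wpDr// sqr_ge0.
rewrite -outer_w sphere_area2 /H => h4.
have -> : (pi / 2 : R) = 4^-1 * (2 * pi) by field.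
by rewrite EFinM -muleA -h4 muleA -EFinM mulVf// mul1e.
Qed.

End inversion.

End abel.

(** * The Abel transform of the derivative of a profile *)

Section abel2.
Context {R : realType}.
Local Notation mu := (@lebesgue_measure R).

(** At an interior point of the half-line, the derivative relative to the half-line
    is the ordinary one. *)
Lemma half_derive_is_derive (J : R -> R) (r : R) : 0 < r -> half_derivable J r ->
  is_derive r 1 J (half_derive J r).
Proof.
move=> r0 dJ; apply/is_derive1_caratheodory.
pose g z := if z == r then half_derive J r else half_quotient J r z.
exists g; split; last by rewrite /g eqxx.
- move=> z; rewrite /g; case: eqP => [->|/eqP zr]; first by rewrite !subrr mulr0.
  by rewrite /half_quotient mulfVK// subr_eq0.
- apply/continuous_withinNx.
  have gr : g r = half_derive J r by rewrite /g eqxx.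
  have H : half_quotient J r z @[z --> within `[0, +oo[ r^'] --> half_derive J r by exact: dJ.
  rewrite gr; move=> P /H; rewrite /nbhs/= /dnbhs /within/= => HP.
  have {}HP : \forall z \near r, z != r -> `[0, +oo[%classic z -> P (half_quotient J r z) := HP.
  have Hg : \forall z \near r, z != r -> P (g z).
    near=> z => zr; rewrite /g ifN//.
    have : z != r -> `[0, +oo[%classic z -> P (half_quotient J r z) by near: z.
    apply => //; rewrite /= in_itv/= andbT ltW//.
    by near: z; exact: lt_nbhsr.
  exact: Hg.
Unshelve. all: by end_near. Qed.

Lemma powR_cvgy (b : R) : 0 < b -> x `^ b @[x --> +oo] --> +oo.
Proof.
move=> b0; apply/cvgryPge => M.
near=> x.
have x1 : (Num.max M 1) `^ b^-1 <= x by near: x; apply: nbhs_pinfty_ge; rewrite num_real.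
have m0 : 0 < Num.max M 1 by rewrite lt_max ltr01 orbT.
apply: (@le_trans _ _ (Num.max M 1)); first by rewrite le_max lexx.
rewrite -[leLHS]powRr1 ?(ltW m0)// -(@mulVf _ b) ?gt_eqF// powRrM.
apply: ge0_ler_powR => //; first exact: ltW.
- by rewrite nnegrE powR_ge0.
- by rewrite nnegrE (le_trans _ x1)// powR_ge0.
Unshelve. all: by end_near. Qed.

Section limits.
Variables (J : R -> R) (a C : R).
Local Notation f := (half_derive J).
Hypothesis cf : {in `]0, +oo[, continuous f}.
Hypothesis fC : forall w, 0 < w -> `|f w| <= C * expR (- w).
Hypothesis fCa : forall w, 0 < w -> `|f w| <= C / w `^ a * expR (- w).
Hypothesis a12 : 1 / 2 < a.

Lemma abelE r : abel J r = - (2 * r / pi) * coshint f r.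
Proof. by []. Qed.

Lemma continuous_abel : {in `]0, +oo[, continuous (abel J)}.
Proof.
move=> r r0; apply: cvgM; last exact: (continuous_coshint cf fC).
apply: cvgN; apply: cvgM; last exact: cvg_cst.
by apply: cvgM; [exact: cvg_cst|exact: cvg_id].
Qed.

Let C0 : 0 <= C.
Proof.
by have := le_trans (normr_ge0 _) (fC ltr01); rewrite pmulr_lge0 ?expR_gt0.
Qed.

Let K := 2 / pi * C * Num.sqrt (2 * pi).

(** [D] may depend on [r]: near infinity [D = C / r `^ a] improves on [C]. *)
Lemma abel_le r D : 0 < r -> (forall w, r <= w -> `|f w| <= D * expR (- w)) ->
  `|abel J r| <= 2 / pi * D * Num.sqrt (2 * pi) * Num.sqrt r * expR (- r).
Proof.
move=> r0 fD; have := coshint_le cf r0 fD.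
have D0 : 0 <= D.
  by have := le_trans (normr_ge0 _) (fD _ (lexx r)); rewrite pmulr_lge0 ?expR_gt0.
move=> /le_trans /(_ (ler_wpM2l D0 (M0_le r0))) h.
have p0 := @pi_gt0 R.
rewrite abelE normrM normrN (@ger0_norm _ (2 * r / pi)); last first.
  by rewrite divr_ge0 ?pi_ge0// mulr_ge0// ltW.
apply: (@le_trans _ _ (2 * r / pi * (D * (expR (- r) * (Num.sqrt (2 * pi) / Num.sqrt r))))).
  by rewrite ler_wpM2l// divr_ge0 ?pi_ge0// mulr_ge0// ltW.
rewrite le_eqVlt; apply/orP; left; apply/eqP.
have s0 : 0 < Num.sqrt r by rewrite sqrtr_gt0.
rewrite -[X in 2 * X / pi](sqr_sqrtr (ltW r0)); move: (Num.sqrt r) s0 => s s0.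
move: (Num.sqrt (2 * pi : R)) (pi : R) p0 => q p p0.
by field; rewrite !gt_eqF.
Qed.

Lemma abel_cvg0 : abel J r @[r --> 0^'+] --> 0.
Proof.
apply: norm_cvg0.
apply: (@squeeze_cvgr _ _ _ _ (fun=> 0) (fun r => K * Num.sqrt r)); last 2 first.
- exact: cvg_cst.
- rewrite -[X in _ --> X](mulr0 K); apply: cvgM; first exact: cvg_cst.
  apply: cvg_at_right_filter; rewrite -[X in _ --> X](@sqrtr0 R).
  exact: sqrt_continuous.
near=> r; have r0 : 0 < r by near: r; exact: nbhs_right_gt.
rewrite normr_ge0/=; apply: (le_trans (@abel_le r C r0 _)).
  by move=> w rw; apply: fC; exact: lt_le_trans rw.
have K0 : 0 <= K by rewrite !mulr_ge0 ?sqrtr_ge0 ?invr_ge0 ?pi_ge0 ?C0.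
rewrite -/K ler_piMr; first by [].
  by rewrite mulr_ge0 ?sqrtr_ge0.
by rewrite expR_le1 oppr_le0 ltW.
Unshelve. all: by end_near. Qed.

Lemma abel_cvgy : expR r * abel J r @[r --> +oo] --> 0.
Proof.
apply: norm_cvg0.
apply: (@squeeze_cvgr _ _ _ _ (fun=> 0) (fun r => K * (r `^ (a - 1 / 2))^-1)); last 2 first.
- exact: cvg_cst.
- rewrite -[X in _ --> X](mulr0 K); apply: cvgM; first exact: cvg_cst.
  apply/gtr0_cvgV0; last by apply: powR_cvgy; rewrite subr_gt0.
  by near=> r; apply: powR_gt0; near: r; exact: nbhs_pinfty_gt.
near=> r; have r0 : 0 < r by near: r; exact: nbhs_pinfty_gt.
rewrite normr_ge0/= normrM (@ger0_norm _ (expR r)) ?expR_ge0//.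
have ra0 : 0 < r `^ a by exact: powR_gt0.
have aN : 0 <= a by rewrite (le_trans _ (ltW a12))// divr_ge0.
have := @abel_le r (C / r `^ a) r0.
move=> /(_ _)/wrap[w rw|h].
  have w0 := lt_le_trans r0 rw.
  apply: (le_trans (fCa w0)); rewrite ler_wpM2r ?expR_ge0// ler_wpM2l//.
  by rewrite lef_pV2 ?posrE ?powR_gt0// ge0_ler_powR// nnegrE ltW.
apply: (le_trans (ler_wpM2l (expR_ge0 r) h)).
have e0 := expRxMexpNx_1 r.
have -> : r `^ (a - 1 / 2) = r `^ a / Num.sqrt r.
  rewrite powRB; last by rewrite (gt_eqF r0) implybT.
  by rewrite div1r powR12_sqrt// ltW.
have s0 : 0 < Num.sqrt r by rewrite sqrtr_gt0.
rewrite le_eqVlt; apply/orP; left; apply/eqP; rewrite /K.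
transitivity (expR r * expR (- r) *
  (2 / pi * (C / r `^ a) * Num.sqrt (2 * pi) * Num.sqrt r)); first by ring.
rewrite e0; have p0 := @pi_gt0 R.
move: (Num.sqrt (2 * pi : R)) (pi : R) p0 => q p p0.
by field; rewrite !gt_eqF.
Unshelve. all: by end_near. Qed.

End limits.

End abel2.

(** * Inversion of the Abel transform *)

Section abel3.
Context {R : realType}.
Local Notation mu := (@lebesgue_measure R).

Lemma derivable_continuous_at (G : R -> R) (w dG : R) :
  is_derive w 1 G dG -> {for w, continuous G}.
Proof. by move=> /@ex_derive/derivable1_diffP/differentiable_continuous. Qed.

Lemma ge0_derive_le (G g : R -> R) (x y : R) :
  (forall w : R, 0 < w -> is_derive w 1 G (g w)) -> (forall w, 0 < w -> 0 <= g w) ->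
  0 < x -> x <= y -> G x <= G y.
Proof.
move=> dG g0 x0; rewrite le_eqVlt => /predU1P[->//|xy].
have [||c] := @MVT _ G g x y xy.
- by move=> w /[!in_itv]/= /andP[xw _]; apply: dG; exact: lt_trans xw.
- apply: continuous_in_subspaceT => w /[!inE]/= /[!in_itv]/= /andP[xw _].
  by apply: (derivable_continuous_at (dG _ _)); exact: lt_le_trans xw.
rewrite in_itv/= => /andP[xc _] GG.
by rewrite -subr_ge0 GG mulr_ge0 ?subr_ge0 ?g0 ?(lt_trans x0)// ltW.
Qed.

(** The integral of [g] in [ge0_abel_inversion] is [- G r] by the fundamental theorem
    of calculus.  It is finite, whence the integrability. *)
Lemma abel_inversion_primitive (g G : R -> R) (C r : R) : 0 < r ->
  {in `]0, +oo[, continuous g} -> (forall w, 0 < w -> 0 <= g w) ->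
  (forall w, 0 < w -> `|g w| <= C * expR (- w)) ->
  (forall w : R, 0 < w -> is_derive w 1 G (g w)) -> G w @[w --> +oo] --> 0 ->
  let B t := r * cosh t * coshint g (r * cosh t) in
  mu.-integrable `[0, +oo[ (EFin \o B) /\
  \int[mu]_(t in `[0, +oo[) B t = pi / 2 * - G r.
Proof.
move=> r0 cg g0 gC dG Gy B.
have rc t : 0 < r * cosh t by rewrite mulr_gt0 ?cosh_gt0.
have gi t : mu.-integrable `[0, +oo[ (EFin \o (fun s => g (r * cosh t * cosh s))).
  by apply: (integrable_coshint cg (rc t)) => w rw; apply: gC; exact: lt_le_trans rw.
have mgs t D : measurable D -> measurable_fun D (fun s => g (r * cosh t * cosh s)).
  move=> mD; apply: (measurable_comp _ _ (measurable_funoy cg)); first exact: measurable_itv.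
    by move=> _ [s _ <-]; rewrite /= in_itv/= mulr_gt0// cosh_gt0.
  by apply: measurable_funTS; apply: measurable_funM => //; exact: measurable_cosh.
have BE t : ((B t)%:E = \int[mu]_(s in `]0%R, +oo[)
    (r * cosh t * g (r * cosh t * cosh s))%:E)%E.
  rewrite /B EFinM /coshint /Rintegral fineK; last exact: (integrable_fin_num _ (gi t)).
  rewrite -ge0_integralZl//; last 3 first.
  - by apply/measurable_EFinP; exact: mgs.
  - by move=> s _; rewrite lee_fin g0// mulr_gt0 ?rc ?cosh_gt0.
  - by rewrite lee_fin ltW.
  rewrite -integral_itv_obnd_cbnd//.
  apply/measurable_EFinP; apply: measurable_funM => //; exact: mgs.
have cB : continuous B.
  have cc : continuous (fun t => r * cosh t).
    by move=> t; apply: cvgM; [exact: cvg_cst|exact: continuous_cosh].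
  move=> t; apply: cvgM; first exact: cc.
  apply: (@continuous_comp _ _ _ (fun t => r * cosh t) (coshint g)); first exact: cc.
  by apply: (continuous_coshint cg gC); rewrite in_itv/= andbT.
have mB : measurable_fun setT B by exact: continuous_measurable_fun.
have B0 t : 0 <= B t.
  rewrite mulr_ge0 ?(ltW (rc t))//; apply: Rintegral_ge0 => s _.
  by rewrite g0// mulr_gt0 ?rc ?cosh_gt0.
have IG : (\int[mu]_(w in `]r, +oo[) (g w)%:E = (- G r)%:E)%E.
  rewrite integral_itv_obnd_cbnd; last first.
    apply/measurable_EFinP; apply: (measurable_funS _ _ (measurable_funoy cg)) => // w /=.
    by rewrite !in_itv/= !andbT; exact: lt_trans.
  rewrite (@ge0_continuous_FTC2y _ g G r 0)//.
  - by rewrite sub0e EFinN.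
  - by move=> w rw; apply: g0; exact: lt_le_trans rw.
  - apply: continuous_in_subspaceT => w /[!inE]/=; rewrite !in_itv/= !andbT => rw.
    by apply: cg; rewrite in_itv/= andbT (lt_le_trans r0).
  - by move=> w rw; have /@ex_derive := dG _ (lt_trans r0 rw).
  - by apply: cvg_at_right_filter; exact: (derivable_continuous_at (dG _ r0)).
  - move=> w; rewrite in_itv/= andbT => rw; rewrite derive1E.
    by have /@derive_val := dG _ (lt_trans r0 rw).
have IB : (\int[mu]_(t in `[0%R, +oo[) (B t)%:E = (pi / 2 * - G r)%:E)%E.
  rewrite -integral_itv_obnd_cbnd; last exact/measurable_EFinP/measurable_funTS.
  under eq_integral do rewrite BE.
  by rewrite ge0_abel_inversion// IG EFinM.
split; last by rewrite /Rintegral IB.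
apply/integrableP; split; first exact/measurable_EFinP/measurable_funTS.
under eq_integral => t _ do rewrite /= ger0_norm//.
by rewrite IB ltry.
Qed.

Section representation.
Variables (J : R -> R) (C : R).
Local Notation f := (half_derive J).
Hypothesis cf : {in `]0, +oo[, continuous f}.
Hypothesis fC : forall w, 0 < w -> `|f w| <= C * expR (- w).
Hypothesis dJ : forall w : R, 0 < w -> is_derive w 1 J (f w).

(** Adding the exponential majorant [E] to [f] yields a nonnegative function, to
    which Tonelli's theorem applies. *)
Let E w := C * expR (- w).

Let dE (w : R) : is_derive w 1 (fun w => - E w) (E w).
Proof.
have h := is_deriveN (is_deriveZ C (is_derive_expRN w)).
by move/is_derive_eq : h; apply; rewrite /GRing.scale/= /E mulrN opprK.
Qed.

Let C0 : 0 <= C.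
Proof.
by have := le_trans (normr_ge0 _) (fC ltr01); rewrite pmulr_lge0 ?expR_gt0.
Qed.

Let E0 w : 0 <= E w.
Proof. by rewrite mulr_ge0 ?expR_ge0. Qed.

Let cE : continuous E.
Proof. by move=> w; apply: cvgM; [exact: cvg_cst|exact: continuous_expRN]. Qed.

Let Ey : E w @[w --> +oo] --> 0.
Proof.
rewrite -[X in _ --> X](mulr0 C); apply: cvgM; first exact: cvg_cst.
exact: cvgr_expR.
Qed.

Let g w := f w + E w.

Let cg : {in `]0, +oo[, continuous g}.
Proof. by move=> w w0; apply: cvgD; [exact: cf|exact: cE]. Qed.

Let g0 w : 0 < w -> 0 <= g w.
Proof. by move=> /fC; rewrite ler_norml -/(E w) => /andP[]; rewrite -lerBlDr sub0r. Qed.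

Let dg (w : R) : 0 < w -> is_derive w 1 (fun w => J w - E w) (g w).
Proof. by move=> w0; exact: (is_deriveD (dJ w0) (dE w)). Qed.

(** [J - E] is nondecreasing and [J + E] is nonincreasing, while [E] vanishes at
    infinity. *)
Lemma profile_cvgy : exists l : R, J w @[w --> +oo] --> l.
Proof.
pose G w := J w - E w.
(* [G] is monotone on the half-line only; [H] is monotone everywhere. *)
pose H (w : R) := G (Num.max w 1).
have max0 (w : R) : 0 < Num.max w 1 by rewrite lt_max ltr01 orbT.
have incH (x y : R) : x <= y -> H x <= H y.
  move=> xy; apply: (ge0_derive_le dg g0) => //.
  by rewrite ge_max !le_max xy lexx orbT.
have ubH : has_ubound (range H).
  exists (J 1 + E 1) => _ [w _ <-].
  have dN (v : R) : 0 < v -> is_derive v 1 (fun v => - (J v - - E v)) (- (f v - E v)).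
    by move=> v0; exact: (is_deriveN (is_deriveB (dJ v0) (dE v))).
  have N0 v : 0 < v -> 0 <= - (f v - E v).
    by move=> /fC; rewrite ler_norml -/(E v) oppr_ge0 subr_le0 => /andP[].
  have w1 : 1 <= Num.max w 1 by rewrite le_max lexx orbT.
  have := ge0_derive_le dN N0 ltr01 w1.
  rewrite lerN2 !opprK; apply: le_trans; rewrite /H /G lerD2l.
  by apply: (@le_trans _ _ 0); rewrite ?oppr_le0 E0.
exists (sup (range H)).
have HG : G w @[w --> +oo] --> sup (range H).
  apply: (cvg_trans _ (nondecreasing_cvgr incH ubH)); apply: near_eq_cvg.
  near=> w; rewrite /H max_l//; near: w; exact: nbhs_pinfty_ge.
have -> : J = (fun w => G w + E w) by apply/funext => w; rewrite /G subrK.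
by rewrite -[X in _ --> X]addr0; exact: cvgD.
Unshelve. all: by end_near. Qed.

Hypothesis Jy : J w @[w --> +oo] --> 0.

(** Subtract [abel_inversion_primitive] for [E] from the same for [f + E]. *)
Lemma abel_inversion r : 0 < r ->
  mu.-integrable `[0, +oo[ (EFin \o (fun t => abel J (r * cosh t))) /\
  \int[mu]_(t in `[0, +oo[) abel J (r * cosh t) = J r.
Proof.
move=> r0.
have gC w : 0 < w -> `|g w| <= (C + C) * expR (- w).
  move=> w0; rewrite mulrDl (le_trans (ler_normD _ _))// lerD ?fC// ger0_norm//.
have EC w : 0 < w -> `|E w| <= C * expR (- w) by move=> _; rewrite ger0_norm.
have Gy : J w - E w @[w --> +oo] --> 0 by rewrite -[X in _ --> X](subr0 0); exact: cvgB.
have Ny : - E w @[w --> +oo] --> 0 by rewrite -oppr0; exact: cvgN.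
have [i1 I1] := abel_inversion_primitive r0 cg g0 gC dg Gy.
have [i2 I2] := abel_inversion_primitive r0 (fun w _ => cE (x := w))
  (fun w _ => E0 w) EC (fun w _ => dE w) Ny.
pose B1 t := r * cosh t * coshint g (r * cosh t).
pose B2 t := r * cosh t * coshint E (r * cosh t).
have AE t : abel J (r * cosh t) = - (2 / pi) * (B1 t - B2 t).
  have rc : 0 < r * cosh t by rewrite mulr_gt0 ?cosh_gt0.
  rewrite abelE.
  have -> : coshint f (r * cosh t) = coshint g (r * cosh t) - coshint E (r * cosh t).
    rewrite /coshint -RintegralB//; last 2 first.
    - by apply: (integrable_coshint cg rc) => w rw; apply: gC; exact: lt_le_trans rw.
    - apply: (integrable_coshint (fun w _ => cE (x := w)) rc) => w rw.
      by apply: EC; exact: lt_le_trans rw.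
    by apply: eq_Rintegral => s _; rewrite /g addrK.
  by rewrite /B1 /B2; ring.
have -> : (fun t => abel J (r * cosh t)) = (fun t => - (2 / pi) * (B1 t - B2 t)).
  by apply/funext.
have iB : mu.-integrable `[0, +oo[ (EFin \o (fun t => B1 t - B2 t)).
  by have := integrableB _ i1 i2; apply.
split; first by have := integrableZl _ (- (2 / pi)) iB; apply.
rewrite RintegralZl// RintegralB// I1 I2.
have p0 := @pi_gt0 R; move: (pi : R) p0 => p p0.
by field; rewrite gt_eqF.
Qed.

End representation.

End abel3.

(** * Decay of radial profiles *)

Section bounds.
Context {R : realType}.
Local Notation mu := (@lebesgue_measure R).

(** The limit bounds [f] beyond some [M >= 1] and continuity bounds it on [`[0, M]];
    for [0 < w <= M] both [expR (- w)] and [1 / w `^ a] are bounded below. *)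
Lemma exp_decay_bound (f : R -> R) (a : R) : 0 <= a ->
  {within `[0, +oo[, continuous f} ->
  cvg (r `^ a * expR r * f r @[r --> +oo]) ->
  exists C, (forall w, 0 < w -> `|f w| <= C * expR (- w)) /\
            (forall w, 0 < w -> `|f w| <= C / w `^ a * expR (- w)).
Proof.
move=> a0 cf /cvg_ex[l /= fl].
have : \forall r \near +oo, `|r `^ a * expR r * f r| < `|l| + 1.
  by apply: cvgr_norm_lt fl _ _; rewrite ltrDl.
move=> [M0 [_ HM]].
pose M := Num.max M0 1 + 1.
have M1 : 1 <= M by rewrite /M -[leLHS]add0r lerD// le_max ler01 orbT.
have M0M : M0 < M by rewrite /M ltr_pwDr// le_max lexx.
have M_ge0 : 0 <= M by exact: le_trans M1.
have [|c _ fc] := @EVT_max _ (fun x => `|f x|) 0 M M_ge0.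
  have cfM : {within `[0, M], continuous f}.
    apply: continuous_subspaceW cf => x /=; rewrite !in_itv/= => /andP[-> _] //.
  move=> x; apply: (@continuous_comp (subspace `[0, M]) R R f (fun y => `|y|) x); first exact: cfM.
  exact: norm_continuous.
pose D := `|f c|.
have D0 : 0 <= D by exact: normr_ge0.
have fD w : 0 <= w <= M -> `|f w| <= D by move=> wM; apply: fc; rewrite in_itv/=.
have fl' w : M <= w -> `|f w| <= (`|l| + 1) / w `^ a * expR (- w).
  move=> Mw; have w0 : 0 < w by apply: lt_le_trans Mw; exact: lt_le_trans M1.
  have := HM w (lt_le_trans M0M Mw).
  rewrite /= !normrM ger0_norm ?powR_ge0// (ger0_norm (expR_ge0 _)) => /ltW h.
  have wa : 0 < w `^ a by exact: powR_gt0.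
  rewrite expRN ler_pdivlMr ?expR_gt0// ler_pdivlMr//.
  by apply: le_trans h; rewrite le_eqVlt; apply/orP; left; apply/eqP; ring.
have Ma : 1 <= M `^ a.
  by rewrite -(@powRr0 _ M) ler_powR.
exists (`|l| + 1 + D * expR M * M `^ a); split => w w0.
  have [Mw|wM] := leP M w.
    apply: (le_trans (fl' _ Mw)); rewrite ler_wpM2r ?expR_ge0//.
    have wa : 1 <= w `^ a.
      by rewrite -(@powRr0 _ w) ler_powR// (le_trans M1).
    apply: (@le_trans _ _ (`|l| + 1)).
      by rewrite ler_pdivrMr ?(lt_le_trans ltr01 wa)// ler_peMr// addr_ge0.
    by rewrite lerDl !mulr_ge0 ?D0 ?expR_ge0 ?powR_ge0.
  have wM0 : 0 <= w <= M by rewrite !ltW.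
  apply: (le_trans (fD _ wM0)).
  apply: (@le_trans _ _ (D * expR M * M `^ a * expR (- w))); last first.
    by rewrite ler_wpM2r ?expR_ge0// lerDr addr_ge0// normr_ge0.
  have e1 : 1 <= expR M * expR (- w) by rewrite -expRD -expR0 ler_expR subr_ge0 ltW.
  rewrite -!mulrA ler_peMr//.
  rewrite mulrCA mulrC -[leLHS]mulr1.
  by apply: ler_pM.
have wa : 0 < w `^ a by exact: powR_gt0.
have [Mw|wM] := leP M w.
  apply: (le_trans (fl' _ Mw)); rewrite ler_wpM2r ?expR_ge0// ler_wpM2r ?invr_ge0 ?(ltW wa)//.
  by rewrite lerDl !mulr_ge0 ?D0 ?expR_ge0 ?powR_ge0.
have wM0 : 0 <= w <= M by rewrite !ltW.
apply: (le_trans (fD _ wM0)).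
apply: (@le_trans _ _ (D * expR M * M `^ a / w `^ a * expR (- w))); last first.
  rewrite ler_wpM2r ?expR_ge0// ler_wpM2r ?invr_ge0 ?(ltW wa)//.
  by rewrite lerDr addr_ge0// normr_ge0.
have e1 : 1 <= expR M * expR (- w) by rewrite -expRD -expR0 ler_expR subr_ge0 ltW.
have e2 : 1 <= M `^ a / w `^ a.
  by rewrite ler_pdivlMr// mul1r ge0_ler_powR// ?nnegrE// ltW.
have -> : D * expR M * M `^ a / w `^ a * expR (- w) =
    D * ((expR M * expR (- w)) * (M `^ a / w `^ a)).
  by ring.
by rewrite ler_peMr// -[leLHS]mulr1; apply: ler_pM.
Qed.

Lemma integral_oy_cst (c M : R) : 0 < c -> (\int[mu]_(x in `[M, +oo[) c%:E = +oo)%E.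
Proof.
move=> c0; have mE : (mu (`[M, +oo[%classic : set R) = +oo)%E.
  by rewrite lebesgue_measure_itv/= ltry addye.
transitivity (c%:E * +oo)%E; last by rewrite gt0_muley.
by rewrite integral_cst//; congr (_ * _)%E; exact: mE.
Qed.

(** Otherwise, in polar coordinates, [`|J r| * r ^+ n.-1] is bounded below by
    [`|l| / 2] near infinity, and its integral diverges. *)
Lemma integrable_radial_lim0 n (K : Rn R n -> R) (J : R -> R) (l : R) : (0 < n)%N ->
  (lebesgueRn n).-integrable [set: Rn R n] (EFin \o K) ->
  {ae lebesgueRn n, forall x : Rn R n, K x = J (enorm x)} ->
  {in `]0, +oo[, continuous J} -> J w @[w --> +oo] --> l -> l = 0.
Proof.
move=> n0 /integrableP[mK Koo] KJ cJ Jl; apply: contrapT => /eqP l0.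
have cnJ : {in `]0, +oo[, continuous (fun w => `|J w|)}.
  move=> w w0; apply: (@continuous_comp _ _ _ J (fun y : R => `|y|)).
    exact: cJ.
  exact: norm_continuous.
have : (\int[lebesgueRn n]_(x in [set x : Rn R n | (0 < enorm x)%R]) `|J (enorm x)|%:E < +oo)%E.
  apply: le_lt_trans Koo; rewrite ge0_integral_enorm_gt0//; last exact: measurableT_comp.
  apply: ae_ge0_le_integral => //.
  - exact: measurable_enorm_gt0.
  - apply/measurable_EFinP; apply: (@measurable_fun_radial _ _ (fun w => `|J w|)).
    exact: measurable_funoy.
  - by apply: measurable_funTS; exact: measurableT_comp.
  - by apply: filterS KJ => x KJx _; rewrite /= KJx.
rewrite (@ge0_integral_radial _ n (fun w => `|J w|))//.
suff -> : (\int[mu]_(r in `]0%R, +oo[) (`|J r| * r ^+ n.-1)%:E = +oo)%E.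
  by rewrite gt0_muley ?ltxx// lte_fin sphere_areaE// mulr_gt0 ?ball_vol_gt0// ltr0n.
have l2 : 0 < `|l| / 2 by rewrite divr_gt0// normr_gt0.
have : \forall r \near +oo, `|l| / 2 <= `|J r|.
  apply: (cvgr_ge _ (cvg_norm Jl)).
  by rewrite ltr_pdivrMr// mulr_natr mulr2n ltrDl normr_gt0.
move=> [M0 [_ HM]].
pose M := Num.max M0 1 + 1.
have M1 : 1 <= M by rewrite /M -[leLHS]add0r lerD// le_max ler01 orbT.
have M0M : M0 < M by rewrite /M ltr_pwDr// le_max lexx.
have mg : measurable_fun (`]0, +oo[ : set R) (fun r => `|J r| * r ^+ n.-1).
  by apply: measurable_funM; [exact: measurable_funoy|exact: exprn_measurable].
apply/eqP; rewrite eq_le leey/= -(integral_oy_cst M l2).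
apply: (@le_trans _ _ (\int[mu]_(r in `[M, +oo[) (`|J r| * r ^+ n.-1)%:E)%E).
  apply: ge0_le_integral => //.
  - apply/measurable_EFinP; apply: measurable_funS mg => //.
    by move=> r; rewrite /= !in_itv/= !andbT; apply: lt_le_trans; exact: lt_le_trans M1.
  - move=> r; rewrite /= in_itv/= andbT => Mr; rewrite lee_fin.
    apply: (le_trans (HM r (lt_le_trans M0M Mr))).
    by rewrite ler_peMr// exprn_ege1// (le_trans M1).
apply: ge0_subset_integral => //.
- exact/measurable_EFinP.
- move=> r; rewrite /= in_itv/= andbT => r0; rewrite lee_fin mulr_ge0// exprn_ge0// ltW//.
- by move=> r; rewrite /= !in_itv/= !andbT; apply: lt_le_trans; exact: lt_le_trans M1.
Qed.

End bounds.

(** * From a maximum on the unit interval to an L1 norm *)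

Section final.
Context {R : realType}.
Local Notation mu := (@lebesgue_measure R).

Lemma lnN_cvgy : - ln l @[l --> (0 : R)^'+] --> +oo.
Proof.
apply/cvgryPge => M; near=> l.
have l0 : 0 < l by near: l; exact: nbhs_right_gt.
rewrite lerNr -ler_expR lnK ?posrE//; near: l.
by apply: nbhs_right_le; exact: expR_gt0.
Unshelve. all: by end_near. Qed.

Lemma lnN_cvg0 : - ln l @[l --> (1 : R)^'-] --> 0^'+.
Proof.
move=> A; rewrite /at_right/within/= => -[e /= e0 He].
have h : - ln l @[l --> (1 : R)^'-] --> (0 : R).
  apply: cvg_at_left_filter; rewrite -[X in _ --> X]oppr0 -ln1.
  by apply: cvgN; exact: continuous_ln.
have h1 : \forall l \near (1 : R)^'-, `|0 - - ln l| < e by move/cvgrPdist_lt : h; exact.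
have h2 : \forall l \near (1 : R)^'-, 0 < l by apply: nbhs_left_gt.
have h3 : \forall l \near (1 : R)^'-, l < 1 by exact: nbhs_left_lt.
apply: filterS3 h1 h2 h3 => l le l0 l1; apply: He => //.
by rewrite oppr_gt0 -(@ln1 R) ltr_ln ?posrE.
Qed.

(** In the variable [l = expR (- r)], the two limits of [phi] say that [H] is
    continuous at the endpoints [0] and [1]. *)
Lemma max_error_exp (phi H : R -> R) (P : {poly R}) :
  {in `]0, +oo[, continuous phi} ->
  phi r @[r --> +oo] --> H 0 -> phi r @[r --> 0^'+] --> H 1 ->
  (forall l, 0 < l < 1 -> H l = phi (- ln l)) ->
  exists M, is_maximum [set `|H l - P.[l]| | l in `[0, 1]] M /\
    forall r, 0 < r -> `|phi r - P.[expR (- r)]| <= M.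
Proof.
move=> cphi phiy phi0 HE.
have cH : {within `[0, 1], continuous H}.
  apply/continuous_within_itvP => //; split.
  - move=> l l01; have := l01; rewrite in_itv/= => l01'; have /andP[l0 l1] := l01'.
    rewrite /continuous_at HE//.
    apply: (@cvg_trans _ (phi (- ln x) @[x --> l])).
      apply: near_eq_cvg; near=> x; rewrite HE//.
      suff : x \in `]0, 1[ by rewrite in_itv.
      by near: x; exact: near_in_itvoo.
    apply: (@continuous_comp _ _ _ (fun x : R => - ln x) phi).
      by apply: cvgN; exact: continuous_ln.
    by apply: cphi; rewrite in_itv/= andbT oppr_gt0 ln_lt0.
  - apply: (@cvg_trans _ (phi (- ln x) @[x --> 0^'+])).
      apply: near_eq_cvg; near=> x; rewrite HE//; apply/andP; split.
        by near: x; exact: nbhs_right_gt.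
      by near: x; exact: nbhs_right_lt.
    exact: cvg_comp lnN_cvgy phiy.
  - apply: (@cvg_trans _ (phi (- ln x) @[x --> 1^'-])).
      apply: near_eq_cvg; near=> x; rewrite HE//; apply/andP; split.
        by near: x; exact: nbhs_left_gt.
      by near: x; exact: nbhs_left_lt.
    exact: cvg_comp lnN_cvg0 phi0.
have cE : {within `[0, 1], continuous (fun l => `|H l - P.[l]|)}.
  move=> x.
  apply: (@continuous_comp (subspace (`[0, 1] : set R)) R R
    (fun l => H l - P.[l]) (fun y => `|y|) x); last first.
    exact: norm_continuous.
  apply: cvgB; first exact: cH.
  exact: (continuous_subspaceT (@continuous_horner _ P)).
have [c c01 cmax] := EVT_max ler01 cE.
exists `|H c - P.[c]|; split; first split.
- by exists c.
- by move=> _ [l l01 <-]; exact: cmax.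
- move=> r r0; have e01 : 0 < expR (- r) < 1 by rewrite expR_gt0 expR_lt1 oppr_lt0.
  have := cmax (expR (- r)); rewrite HE// expRK opprK; apply.
  by rewrite in_itv/= !ltW//; case/andP: e01.
Unshelve. all: by end_near. Qed.

Lemma approx_polyE n N (alpha : nat -> R) r :
  expR (- r) * (approx_poly n N alpha).[expR (- r)] =
  \sum_(1 <= j < N.+2) alpha j * coef n j.-1 * expR (- (j%:R * r)).
Proof.
rewrite horner_poly big_distrr big_add1 big_mkord; apply: eq_bigr => j _ /=.
by rewrite mulrCA -exprS -expRM_natl mulrN.
Qed.

(** Multiply by [expR (- r)] and use [approx_polyE]. *)
Lemma weighted_error n N (alpha : nat -> R) (B : R -> R) M :
  (forall r, 0 < r -> `|expR r * B r - (approx_poly n N alpha).[expR (- r)]| <= M) ->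
  forall r, 0 < r ->
  `|B r - \sum_(1 <= j < N.+2) alpha j * coef n j.-1 * expR (- (j%:R * r))| <= M * expR (- r).
Proof.
move=> h r /h; rewrite -approx_polyE => {}h.
have -> : B r - expR (- r) * (approx_poly n N alpha).[expR (- r)] =
   expR (- r) * (expR r * B r - (approx_poly n N alpha).[expR (- r)]).
  by rewrite mulrBr mulrA -expRD addNr expR0 mul1r.
by rewrite normrM ger0_norm ?expR_ge0// mulrC ler_wpM2r ?expR_ge0.
Qed.

Lemma Lnorm1_radial_le n (K : Rn R n -> R) (J G W : R -> R) (M : R) : (0 < n)%N ->
  (lebesgueRn n).-integrable [set: Rn R n] (EFin \o K) ->
  {ae lebesgueRn n, forall x : Rn R n, K x = J (enorm x)} ->
  measurable_fun (`]0, +oo[ : set R) G ->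
  {in `]0, +oo[, continuous W} -> (forall r, 0 < r -> 0 <= W r) ->
  (\int[mu]_(r in `]0%R, +oo[) (W r * r ^+ n.-1)%:E <= 1)%E ->
  0 <= M -> (forall r, 0 < r -> `|J r - G r| <= M * W r) ->
  ('N[lebesgueRn n]_1[EFin \o (K \- (G \o @enorm R n))%R] <= (sphere_area n * M)%:E)%E.
Proof.
move=> n0 /integrableP[mK _] KJ mG cW W0 W1 M0 JG.
rewrite Lnorm1.
have mGe : measurable_fun [set: Rn R n] (G \o @enorm R n).
  move/measurable_fun_itv_obnd_cbndP : mG => mG.
  apply: (measurable_comp _ _ mG); first exact: measurable_itv.
    by move=> _ [x _ <-]; rewrite /= in_itv/= enorm_ge0.
  exact: measurable_enorm.
have mf : measurable_fun [set: Rn R n] (fun x => `|(K x - G (enorm x))%:E|%E).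
  apply: measurableT_comp => //; apply/measurable_EFinP/measurable_funB => //.
  exact/measurable_EFinP.
have cMW : {in `]0, +oo[, continuous (fun r => M * W r)}.
  by move=> r r0; apply: cvgM; [exact: cvg_cst|exact: cW].
rewrite ge0_integral_enorm_gt0//.
apply: (@le_trans _ _ (\int[lebesgueRn n]_(x in [set x : Rn R n | (0 < enorm x)%R])
    (M * W (enorm x))%:E)%E).
  apply: ae_ge0_le_integral => //.
  - exact: measurable_enorm_gt0.
  - by apply: measurable_funTS.
  - by move=> x x0; rewrite lee_fin mulr_ge0 ?W0.
  - apply/measurable_EFinP; apply: (@measurable_fun_radial _ _ (fun w => M * W w)).
    exact: measurable_funoy.
  - by apply: filterS KJ => x KJx x0; rewrite /= lee_fin KJx JG.
rewrite (@ge0_integral_radial _ n (fun w => M * W w))//; last by move=> r r0; rewrite mulr_ge0 ?W0.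
rewrite (EFinM (sphere_area n) M); apply: lee_wpmul2l.
  by rewrite lee_fin sphere_areaE// mulr_ge0// ball_vol_ge0.
under eq_integral do rewrite -mulrA EFinM.
rewrite ge0_integralZl//; last 2 first.
- apply/measurable_EFinP; apply: measurable_funM; first exact: measurable_funoy.
  exact: exprn_measurable.
- by move=> r; rewrite /= in_itv/= andbT => r0; rewrite lee_fin mulr_ge0 ?W0// exprn_ge0// ltW.
by rewrite -[leRHS]mule1; apply: lee_wpmul2l; rewrite ?lee_fin.
Qed.

End final.

(** * Masses of the Green functions *)

Section weights.
Context {R : realType}.
Local Notation mu := (@lebesgue_measure R).

Lemma cvgr_invr : r^-1 @[r --> +oo] --> (0 : R).
Proof.
apply/gtr0_cvgV0; last exact: cvg_id.
exact: nbhs_pinfty_gt.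
Qed.

Lemma is_derive_expNM (c x : R) :
  is_derive x 1 (fun r => expR (- (r * c))) (- c * expR (- (x * c))).
Proof.
have d : is_derive x 1 (fun r : R => - (r * c)) (- c).
  have -> : (fun r : R => - (r * c)) = (- c) \*: (id : R -> R).
    by apply/funext => r; rewrite /= /GRing.scale/= mulNr mulrC.
  have := is_deriveZ (- c) (is_derive_id x (1 : R)).
  by move/is_derive_eq; apply; rewrite /GRing.scale/= mulr1.
have := @is_derive1_comp R expR (fun r => - (r * c)) x _ _ (is_derive_expR _) d.
by move/is_derive_eq; apply; rewrite mulrC.
Qed.

Lemma continuous_expNM (c : R) : continuous (fun r : R => expR (- (r * c))).
Proof.
move=> x; exact: (derivable_continuous_at (is_derive_expNM c x)).
Qed.

Lemma continuous_expN_lin (c : R) : continuous (fun r : R => expR (- (c * r))).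
Proof.
have -> : (fun r : R => expR (- (c * r))) = (fun r : R => expR (- (r * c))).
  by apply/funext => r; rewrite mulrC.
exact: continuous_expNM.
Qed.

Lemma expNM_cvg0 (c : R) : 0 < c -> expR (- (r * c)) @[r --> +oo] --> 0.
Proof.
move=> c0; apply: (@cvg_comp _ _ _ (fun r => r * c) (fun y => expR (- y)) _ +oo).
  by apply: gt0_cvgMly => //; exact: cvg_id.
exact: cvgr_expR.
Qed.

Lemma mul_expNM_cvg0 (c : R) : 0 < c -> r * expR (- (r * c)) @[r --> +oo] --> 0.
Proof.
move=> c0.
apply: (@squeeze_cvgr _ _ _ _ (fun=> 0) (fun r => 2 / c ^+ 2 * r^-1)); last 2 first.
- exact: cvg_cst.
- rewrite -[X in _ --> X](mulr0 (2 / c ^+ 2)); apply: cvgM; first exact: cvg_cst.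
  exact: cvgr_invr.
near=> r; have r0 : 0 < r by near: r; exact: nbhs_pinfty_gt.
rewrite mulr_ge0 ?expR_ge0 ?(ltW r0)//=.
have rc0 : 0 < r * c by rewrite mulr_gt0.
have h := expR_ge1Dxn 1 (ltW rc0).
have h' : (r * c) ^+ 2 / 2 <= expR (r * c).
  by apply: le_trans h; rewrite lerDr.
rewrite expRN ler_pdivrMr ?expR_gt0//.
have k0 : 0 <= 2 / c ^+ 2 * r^-1.
  by rewrite mulr_ge0 ?invr_ge0 ?(ltW r0)// divr_ge0// exprn_ge0// ltW.
apply: le_trans (ler_wpM2l k0 h'); rewrite le_eqVlt; apply/orP; left; apply/eqP.
by field; rewrite !gt_eqF.
Unshelve. all: by end_near. Qed.

Lemma integral_expN :
  (\int[mu]_(r in `]0%R, +oo[) (expR (- r) * r ^+ 0)%:E = 1)%E.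
Proof.
under eq_integral do rewrite expr0 mulr1.
rewrite integral_itv_obnd_cbnd; last first.
  apply/measurable_EFinP/measurable_funTS; apply: continuous_measurable_fun.
  exact: continuous_expRN.
rewrite (@ge0_continuous_FTC2y _ _ (fun x => - expR (- x)) _ 0)//.
- by rewrite oppr0 expR0 sub0e -EFinN opprK.
- exact: (continuous_subspaceT continuous_expRN).
- by rewrite -oppr0; apply: cvgN; exact: cvgr_expR.
- by apply: cvg_at_right_filter; apply: cvgN; exact: continuous_expRN.
- move=> x _; rewrite derive1E.
  have := is_deriveN (is_derive_expRN x); rewrite opprK => h.
  by have /@derive_val := h.
Qed.

Lemma integral_mul_expNM (c : R) : 0 < c ->
  (\int[mu]_(r in `]0%R, +oo[) (r * expR (- (r * c)))%:E = (c ^- 2)%:E)%E.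
Proof.
move=> c0.
have cf : continuous (fun r : R => r * expR (- (r * c))).
  by move=> r; apply: cvgM; [exact: cvg_id|exact: continuous_expNM].
rewrite integral_itv_obnd_cbnd; last first.
  by apply/measurable_EFinP/measurable_funTS; exact: continuous_measurable_fun.
pose F r := - (c^-1 * (r * expR (- (r * c))) + c ^- 2 * expR (- (r * c))).
have dF (x : R) : is_derive x 1 F (x * expR (- (x * c))).
  have d1 := is_deriveZ (c^-1) (is_deriveM (is_derive_id x (1 : R)) (is_derive_expNM c x)).
  have d2 := is_deriveZ (c ^- 2) (is_derive_expNM c x).
  have := is_deriveN (is_deriveD d1 d2).
  move/is_derive_eq; apply; rewrite /GRing.scale/= mulr1.
  by field; rewrite gt_eqF.
rewrite (@ge0_continuous_FTC2y _ _ F _ 0)//.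
- by rewrite sub0e -EFinN /F opprK !mul0r oppr0 expR0 mulr0 add0r mulr1.
- by move=> x x0; rewrite mulr_ge0 ?expR_ge0.
- exact: continuous_subspaceT.
- rewrite -[X in _ --> X]oppr0; apply: cvgN.
  rewrite -[X in _ --> X]addr0; apply: cvgD.
    rewrite -[X in _ --> X](mulr0 c^-1); apply: cvgM; first exact: cvg_cst.
    exact: mul_expNM_cvg0.
  rewrite -[X in _ --> X](mulr0 (c ^- 2)); apply: cvgM; first exact: cvg_cst.
  exact: expNM_cvg0.
- by apply: cvg_at_right_filter; exact: (derivable_continuous_at (dF 0)).
- by move=> x _; rewrite derive1E; have /@derive_val := dF x.
Qed.

Lemma is_derive_cosh (x : R) : is_derive x 1 (@cosh R) (sinh x).
Proof.
have -> : @cosh R = (2^-1 : R) \*: (expR + (fun x => expR (- x)))%R.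
  by apply/funext => y; rewrite /cosh/= /GRing.scale/= mulrC.
have := is_deriveZ (2^-1 : R) (is_deriveD (is_derive_expR x) (is_derive_expRN x)).
by move/is_derive_eq; apply; rewrite /GRing.scale/= /sinh mulrC.
Qed.

Lemma integral_cosh_sqrV :
  (\int[mu]_(s in `[0%R, +oo[) (cosh s ^- 2)%:E = 1)%E.
Proof.
(* this is [tanh s - 1] *)
pose F (s : R) := - (expR (- s) * (cosh s)^-1).
have c0 s : cosh s != 0 :> R by rewrite gt_eqF// cosh_gt0.
have dF (x : R) : is_derive x 1 F (cosh x ^- 2).
  have := is_deriveN (is_deriveM (is_derive_expRN x) (is_deriveV (c0 x) (is_derive_cosh x))).
  move/is_derive_eq; apply; rewrite /GRing.scale/=.
  have e1 := expRxMexpNx_1 x.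
  have eE : expR x = cosh x + sinh x by rewrite /cosh /sinh; field.
  rewrite -[RHS]mul1r -e1 eE; move: (c0 x) (expR (- x)) => + e.
  by move: (cosh x) (sinh x) => u v u0; field.
rewrite (@ge0_continuous_FTC2y _ _ F _ 0)//.
- have h0 : cosh 0 = 1 :> R by rewrite /cosh oppr0 expR0 divff.
  by rewrite /F h0 oppr0 expR0 invr1 mulr1 sub0e -EFinN opprK.
- by move=> x _; rewrite invr_ge0 exprn_ge0// ltW// cosh_gt0.
- apply: continuous_subspaceT => x; apply: cvgV; first by rewrite expf_neq0.
  by apply: cvgM; exact: continuous_cosh.
- rewrite -[X in _ --> X]oppr0; apply: cvgN.
  apply: (@squeeze_cvgr _ _ _ _ (fun=> 0) (fun s => expR (- s))); last 2 first.
  + exact: cvg_cst.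
  + exact: cvgr_expR.
  near=> s; rewrite mulr_ge0 ?expR_ge0 ?invr_ge0 ?(ltW (cosh_gt0 _))//=.
  by rewrite ler_piMr ?expR_ge0// invf_le1 ?cosh_ge1 ?cosh_gt0.
- by apply: cvg_at_right_filter; exact: (derivable_continuous_at (dF 0)).
- by move=> x _; rewrite derive1E; have /@derive_val := dF x.
Unshelve. all: by end_near. Qed.

(** Exchange the integrals: for fixed [s], the integral of [r * expR (- (r * cosh s))]
    is [cosh s ^- 2]. *)
Lemma integral_M0 :
  (\int[mu]_(r in `]0%R, +oo[) (M0 r * r ^+ 1)%:E = 1)%E.
Proof.
(* the absolute value makes the integrand nonnegative on the whole plane *)
transitivity (\int[mu]_(r in `]0%R, +oo[) \int[mu]_(s in `[0%R, +oo[)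
    (`|r| * expR (- (r * cosh s)))%:E)%E.
  apply: eq_integral => r; rewrite inE/= in_itv/= andbT => r0.
  rewrite expr1 mulrC EFinM /M0 /Rintegral fineK; last first.
    exact: (integrable_fin_num _ (integrable_expN_cosh r0)).
  rewrite -ge0_integralZl//; last 2 first.
  - by apply/measurable_EFinP; exact: measurable_expN_cosh.
  - by rewrite lee_fin ltW.
  by rewrite gtr0_norm.
rewrite (@tonelli_itv _ _ _ (fun z => (`|z.1| * expR (- (z.1 * cosh z.2)))%:E)); last 2 first.
- apply/measurable_EFinP; apply: measurable_funM.
    exact: measurableT_comp.
  apply: measurableT_comp => //; apply: measurable_funN.
  by apply: measurable_funM => //; exact: (measurableT_comp measurable_cosh).
- by move=> z; rewrite lee_fin mulr_ge0 ?expR_ge0.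
rewrite -integral_cosh_sqrV; apply: eq_integral => s _ /=.
rewrite -integral_mul_expNM ?cosh_gt0//.
apply: eq_integral => r; rewrite inE/= in_itv/= andbT => r0.
by rewrite gtr0_norm.
Qed.

End weights.

(** * Approximation on the line and in space *)

Section dims.
Context {R : realType}.
Local Notation mu := (@lebesgue_measure R).

(** What the three dimensions share: [B] is the function for which [hfun n J] is
    [B (- ln l) / l], and the last hypothesis transports a bound on the error from
    [B] to [J], which replaces [expR (- r)] by [W]. *)
Lemma approx_error_le n (K : Rn R n -> R) (J B W : R -> R) N (alpha : nat -> R) :
  (0 < n)%N ->
  (lebesgueRn n).-integrable [set: Rn R n] (EFin \o K) ->
  {ae lebesgueRn n, forall x : Rn R n, K x = J (enorm x)} ->
  {in `]0, +oo[, continuous B} ->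
  expR r * B r @[r --> +oo] --> hfun n J 0 ->
  expR r * B r @[r --> 0^'+] --> hfun n J 1 ->
  (forall l, 0 < l < 1 -> hfun n J l = B (- ln l) / l) ->
  (forall j, (0 < j)%N -> {in `]0, +oo[, continuous (@green R n j)}) ->
  {in `]0, +oo[, continuous W} -> (forall r, 0 < r -> 0 <= W r) ->
  (\int[mu]_(r in `]0%R, +oo[) (W r * r ^+ n.-1)%:E <= 1)%E ->
  (forall M, (forall r, 0 < r ->
      `|B r - \sum_(1 <= j < N.+2) alpha j * coef n j.-1 * expR (- (j%:R * r))|
        <= M * expR (- r)) ->
    forall r, 0 < r -> `|J r - \sum_(1 <= j < N.+2) alpha j * green n j r| <= M * W r) ->
  exists M : R,
    is_maximum
      [set `|hfun n J l - (approx_poly n N alpha).[l]| | l in `[0, 1]] M /\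
    ('N[lebesgueRn n]_1[EFin \o (K \- approx_kernel N.+1 alpha)%R]
       <= (sphere_area n * M)%:E)%E.
Proof.
move=> n0 iK KJ cB By B0 HB cG cW W0 W1 JW.
have cphi : {in `]0, +oo[, continuous (fun r => expR r * B r)}.
  by move=> r r0; apply: cvgM; [exact: continuous_expR|exact: cB].
have HB' l : 0 < l < 1 -> hfun n J l = expR (- ln l) * B (- ln l).
  move=> l01; have /andP[l0 _] := l01.
  by rewrite HB// expRN lnK ?posrE// mulrC.
have [M [Mmax hM]] := max_error_exp (approx_poly n N alpha) cphi By B0 HB'.
exists M; split=> //.
have M0 : 0 <= M by have [[l _ <-] _] := Mmax.
apply: (Lnorm1_radial_le n0 iK KJ _ cW W0 W1 M0 (JW M (weighted_error hM))).
have -> : (fun r : R => \sum_(1 <= j < N.+2) alpha j * green n j r) =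
    (fun r => \sum_(0 <= j < N.+1) alpha j.+1 * green n j.+1 r).
  by apply/funext => r; rewrite big_add1.
apply: measurable_sum => j; apply: measurable_funM => //.
by apply: measurable_funoy; exact: cG.
Qed.

Lemma approx_error_line (K : Rn R 1 -> R) (J : R -> R) N (alpha : nat -> R) :
  (lebesgueRn 1).-integrable [set: Rn R 1] (EFin \o K) ->
  {ae lebesgueRn 1, forall x : Rn R 1, K x = J (enorm x)} ->
  kernel_assumption 1 J ->
  exists M : R,
    is_maximum
      [set `|hfun 1 J l - (approx_poly 1 N alpha).[l]| | l in `[0, 1]] M /\
    ('N[lebesgueRn 1]_1[EFin \o (K \- approx_kernel N.+1 alpha)%R]
       <= (sphere_area 1 * M)%:E)%E.
Proof.
move=> iK KJ [/continuous_within_itvcyP[cJ J0] Jy].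
apply: (approx_error_le (B := J) (W := fun r => expR (- r))) => //.
- by rewrite /hfun eqxx.
- rewrite /hfun oner_eq0 ln1 oppr0 divr1 -[X in _ --> X]mul1r -(@expR0 R).
  apply: cvgM J0; apply: cvg_at_right_filter; exact: continuous_expR.
- by move=> l /andP[l0 _]; rewrite /hfun gt_eqF.
- move=> j _ r _; apply: cvgM; first exact: cvg_cst.
  by have := @continuous_expN_lin R j%:R r.
- by move=> r _; exact: continuous_expRN.
- by rewrite [leLHS](@integral_expN R).
- move=> M h r r0; have := h r r0; congr (`|_ - _| <= _).
  apply: eq_big_nat => j /andP[j1 _]; by rewrite /coef /green prednK// !mulrA.
Qed.

Lemma approx_error_space (K : Rn R 3 -> R) (J : R -> R) N (alpha : nat -> R) :
  (lebesgueRn 3).-integrable [set: Rn R 3] (EFin \o K) ->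
  {ae lebesgueRn 3, forall x : Rn R 3, K x = J (enorm x)} ->
  kernel_assumption 3 J ->
  exists M : R,
    is_maximum
      [set `|hfun 3 J l - (approx_poly 3 N alpha).[l]| | l in `[0, 1]] M /\
    ('N[lebesgueRn 3]_1[EFin \o (K \- approx_kernel N.+1 alpha)%R]
       <= (sphere_area 3 * M)%:E)%E.
Proof.
move=> iK KJ [cJ J0 Jy].
have cJ' : {in `]0, +oo[, continuous J}.
  move: cJ; rewrite continuous_open_subspace; last exact: interval_open.
  by move=> cJ r r0; apply: cJ; rewrite inE.
apply: (approx_error_le (B := fun r => r * J r) (W := fun r => expR (- r) / r)) => //.
- by move=> r r0; apply: cvgM; [exact: cvg_id|exact: cJ'].
- rewrite /hfun eqxx; under eq_fun do rewrite mulrCA mulrA.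
  exact: Jy.
- rewrite /hfun oner_eq0 eqxx -[X in _ --> X]mul1r -(@expR0 R).
  apply: cvgM J0; apply: cvg_at_right_filter; exact: continuous_expR.
- by move=> l /andP[l0 l1]; rewrite /hfun gt_eqF// lt_eqF.
- move=> j _ r; rewrite in_itv/= andbT => r0; apply: cvgM; last first.
    by have := @continuous_expN_lin R j%:R r.
  apply: cvgM; first exact: cvg_cst.
  apply: cvgV; first by rewrite mulf_neq0// ?gt_eqF// mulr_gt0// pi_gt0.
  by apply: cvgM; [exact: cvg_cst|exact: cvg_id].
- move=> r; rewrite in_itv/= andbT => r0; apply: cvgM; first exact: continuous_expRN.
  by apply: cvgV; [rewrite gt_eqF|exact: cvg_id].
- by move=> r r0; rewrite divr_ge0 ?expR_ge0// ltW.
- have := @integral_mul_expNM R 1 ltr01; rewrite expr1n invr1 => <-.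
  rewrite le_eqVlt; apply/orP; left; apply/eqP.
  apply: eq_integral => r; rewrite inE/= in_itv/= andbT => r0.
  by rewrite mulr1; congr EFin; field; rewrite gt_eqF.
- move=> M h r r0.
  have -> : J r - \sum_(1 <= j < N.+2) alpha j * green 3 j r =
      (r * J r - \sum_(1 <= j < N.+2) alpha j * coef 3 j.-1 * expR (- (j%:R * r))) / r.
    rewrite mulrBl mulrAC divff ?gt_eqF// mul1r mulr_suml; congr (_ - _).
    apply: eq_big_nat => j /andP[j1 _]; rewrite /coef /green prednK//.
    have p0 := @pi_gt0 R; move: (pi : R) p0 => p p0.
    by field; rewrite !gt_eqF.
  by rewrite normrM normfV (gtr0_norm r0) mulrA ler_pM2r ?invr_gt0// h.
Qed.

End dims.

(** * Approximation in the plane *)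

Section plane.
Context {R : realType}.
Local Notation mu := (@lebesgue_measure R).

Lemma Rintegral_bigsum d (T : measurableType d) (m : {measure set T -> \bar R})
    (D : set T) (I : Type) (s : seq I) (f : I -> T -> R) : measurable D ->
  (forall i, m.-integrable D (EFin \o f i)) ->
  m.-integrable D (EFin \o (fun x => \sum_(i <- s) f i x)) /\
  \int[m]_(x in D) \sum_(i <- s) f i x = \sum_(i <- s) \int[m]_(x in D) f i x.
Proof.
move=> mD fi; elim: s => [|i s [ih1 ih2]].
  split; last first.
    by rewrite big_nil; under eq_Rintegral do rewrite big_nil; rewrite Rintegral_cst// mul0r.
  under [X in EFin \o X]eq_fun do rewrite big_nil; exact: integrable0.
under [X in EFin \o X]eq_fun do rewrite big_cons.
under eq_Rintegral do rewrite big_cons.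
rewrite big_cons RintegralD// ih2; split => //.
by have := integrableD mD (fi i) ih1; apply.
Qed.

(** What [C1_half J], the decay of [half_derive J] and the integrability of [K] give
    together. *)
Lemma planar_profile (K : Rn R 2 -> R) (J : R -> R) :
  (lebesgueRn 2).-integrable [set: Rn R 2] (EFin \o K) ->
  {ae lebesgueRn 2, forall x : Rn R 2, K x = J (enorm x)} ->
  kernel_assumption 2 J ->
  [/\ {in `]0, +oo[, continuous (abel J)},
      expR r * abel J r @[r --> +oo] --> (0 : R),
      abel J r @[r --> 0^'+] --> (0 : R) &
      forall r, 0 < r ->
        mu.-integrable `[0, +oo[ (EFin \o (fun t => abel J (r * cosh t))) /\
        \int[mu]_(t in `[0, +oo[) abel J (r * cosh t) = J r].
Proof.
move=> iK KJ [[dJ cf] [a a12 fa]].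
have a0 : 0 <= a by rewrite (le_trans _ (ltW a12))// divr_ge0.
have [C [fC fCa]] := exp_decay_bound a0 cf fa.
have cf' : {in `]0, +oo[, continuous (half_derive J)}.
  by case/continuous_within_itvcyP : cf.
have dJ' (w : R) : 0 < w -> is_derive w 1 J (half_derive J w).
  by move=> w0; apply: half_derive_is_derive => //; apply: dJ; exact: ltW.
have cJ : {in `]0, +oo[, continuous J}.
  by move=> w; rewrite in_itv/= andbT => w0; exact: (derivable_continuous_at (dJ' _ w0)).
have [l Jl] := profile_cvgy fC dJ'.
have l0 := integrable_radial_lim0 (isT : (0 < 2)%N) iK KJ cJ Jl.
rewrite l0 in Jl.
split.
- exact: continuous_abel cf' fC.
- exact: abel_cvgy cf' fC fCa a12.
- exact: abel_cvg0 cf' fC.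
- by move=> r r0; exact: abel_inversion cf' fC dJ' Jl r r0.
Qed.

(** Green functions and profile are both averages over [cosh], by the definition of
    [M0] and by [abel_inversion]; so is the difference, and the average of
    [M * expR (- r)] is [M * M0 r]. *)
Lemma approx_error_plane (K : Rn R 2 -> R) (J : R -> R) N (alpha : nat -> R) :
  (lebesgueRn 2).-integrable [set: Rn R 2] (EFin \o K) ->
  {ae lebesgueRn 2, forall x : Rn R 2, K x = J (enorm x)} ->
  kernel_assumption 2 J ->
  exists M : R,
    is_maximum
      [set `|hfun 2 J l - (approx_poly 2 N alpha).[l]| | l in `[0, 1]] M /\
    ('N[lebesgueRn 2]_1[EFin \o (K \- approx_kernel N.+1 alpha)%R]
       <= (sphere_area 2 * M)%:E)%E.
Proof.
move=> iK KJ kJ; have [cA Ay A0 Jrep] := planar_profile iK KJ kJ.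
apply: (approx_error_le (B := abel J) (W := @M0 R)) => //.
- by rewrite /hfun eqxx (cvg_lim _ Ay).
- rewrite /hfun oner_eq0 eqxx (cvg_lim _ A0)// -[X in _ --> X](mulr0 (expR 0)).
  by apply: cvgM A0; apply: cvg_at_right_filter; exact: continuous_expR.
- by move=> l /andP[l0 l1]; rewrite /hfun gt_eqF// lt_eqF.
- move=> j j0 r; rewrite in_itv/= andbT => r0; apply: cvgM; first exact: cvg_cst.
  apply: (@continuous_comp _ _ _ (fun r : R => j%:R * r) (@M0 R)).
    by apply: cvgM; [exact: cvg_cst|exact: cvg_id].
  by apply: continuous_M0; rewrite in_itv/= andbT mulr_gt0// ltr0n.
- exact: continuous_M0.
- by move=> r _; exact: M0_ge0.
- by rewrite [leLHS](@integral_M0 R).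
- move=> M h r r0; have [iA JE] := Jrep r r0.
  pose e j t := alpha j.+1 * coef 2 j * expR (- (j.+1%:R * (r * cosh t))).
  have eE t : \sum_(1 <= j < N.+2) alpha j * coef 2 j.-1 * expR (- (j%:R * (r * cosh t))) =
      \sum_(0 <= j < N.+1) e j t by rewrite big_add1.
  have jr j : 0 < j.+1%:R * r by rewrite mulr_gt0// ltr0n.
  have ie j : mu.-integrable `[0, +oo[ (EFin \o e j).
    have -> : e j = (fun t => alpha j.+1 * coef 2 j * expR (- (j.+1%:R * r * cosh t))).
      by apply/funext => t; rewrite /e mulrA.
    exact: (integrable_cexpN_cosh _ (jr j)).
  have Ie j : \int[mu]_(t in `[0, +oo[) e j t = alpha j.+1 * green 2 j.+1 r.
    rewrite /green /M0 mulrA -RintegralZl//; last exact: integrable_expN_cosh.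
    by apply: eq_Rintegral => t _; rewrite /e mulrA.
  have mD : measurable (`[0, +oo[%classic : set (measurableTypeR R)).
    exact: measurable_itv.
  have [ise Ise] := Rintegral_bigsum (index_iota 0 N.+1) mD ie.
  have -> : J r - \sum_(1 <= j < N.+2) alpha j * green 2 j r =
      \int[mu]_(t in `[0, +oo[) (abel J (r * cosh t) - \sum_(0 <= j < N.+1) e j t).
    rewrite RintegralB// JE Ise big_add1; congr (_ - _).
    by apply: eq_bigr => j _; rewrite Ie.
  have ib := integrableB mD iA ise.
  apply: (le_trans (le_normr_Rintegral _ ib)) => //.
  rewrite /M0 -RintegralZl//; last exact: integrable_expN_cosh.
  apply: le_Rintegral => //.
  + by have /integrable_norm := ib.
  + exact: integrable_cexpN_cosh.
  + by move=> t _; rewrite -eE h// mulr_gt0 ?cosh_gt0.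
Qed.

End plane.

Theorem theorem5 (R : realType) (n : nat) (K : Rn R n -> R) (J : R -> R)
    (N : nat) (alpha : nat -> R) :
  (1 <= n <= 3)%N ->
  (lebesgueRn n).-integrable [set: Rn R n] (EFin \o K) ->
  {ae lebesgueRn n, forall x : Rn R n, K x = J (enorm x)} ->
  kernel_assumption n J ->
  (n = 2%N ->
     expR r * abel J r @[r --> +oo] --> (0 : R) /\
     abel J r @[r --> 0^'+] --> (0 : R)) /\
  exists M : R,
    is_maximum
      [set `|hfun n J l - (approx_poly n N alpha).[l]| | l in `[0, 1]] M /\
    ('N[lebesgueRn n]_1[EFin \o (K \- approx_kernel N.+1 alpha)%R]
       <= (2 * pi `^ (n%:R / 2) / Gamma (n%:R / 2) * M)%:E)%E.
Proof.
case: n K => [|[|[|[|n]]]] K // _ iK KJ kJ.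
- by split => //; exact: approx_error_line iK KJ kJ.
- split; last exact: approx_error_plane iK KJ kJ.
  by move=> _; have [] := planar_profile iK KJ kJ.
- by split => //; exact: approx_error_space iK KJ kJ.
Qed.
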